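(* There exist two infinite trees $T$ and $S$, each of maximum degree three, such that $T$ and $S$ are (vertex-)hypomorphic, and such that there is no embedding $T \hookrightarrow S$ and there is no embedding $S \hookrightarrow T$.
   Context: Two graphs $G$ and $H$ are (vertex-)hypomorphic if there exists a bijection $\varphi \colon V(G) \to V(H)$ such that the induced subgraphs $G - v$ and $H - \varphi(v)$ (obtained by deleting the vertex and its incident edges) are isomorphic for every $v \in V(G)$. An embedding $G \hookrightarrow H$ is an injective map $V(G) \to V(H)$ sending adjacent vertices to adjacent vertices, i.e. an isomorphism of $G$ onto a subgraph of $H$. *)

(* Defs.v *)
From mathcomp Require Import all_boot.
From mathcomp Require Import boolp classical_sets functions cardinality.

Set Implicit Arguments.
Unset Strict Implicit.
Unset Printing Implicit Defensive.

Local Open Scope classical_set_scope.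
Local Open Scope card_scope.

(* Simple graphs on a possibly infinite vertex type. Boolean adjacency is no
   restriction: classically every relation on a type is boolean. *)
Record graph := Graph {
  vertex :> eqType;
  adj : rel vertex;
  adj_sym : symmetric adj;
  adj_irr : irreflexive adj
}.

Section Induced.
Variables (G : graph) (P : pred G).

Definition induced_adj : rel {x : G | P x} := relpre val (@adj G).

Lemma induced_adj_sym : symmetric induced_adj.
Proof. by move=> x y; apply: adj_sym. Qed.

Lemma induced_adj_irr : irreflexive induced_adj.
Proof. by move=> x; apply: adj_irr. Qed.

Definition induced : graph := Graph induced_adj_sym induced_adj_irr.

End Induced.

Definition del_vertex (G : graph) (v : G) : graph := induced (predC1 v).

Definition isomorphic (G H : graph) : Prop :=
  exists f : G -> H, bijective f /\ forall x y, adj (f x) (f y) = adj x y.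

Definition hypomorphic (G H : graph) : Prop :=
  exists phi : G -> H, bijective phi /\
    forall v : G, isomorphic (del_vertex v) (del_vertex (phi v)).

Definition embeds (G H : graph) : Prop :=
  exists f : G -> H, injective f /\ forall x y, adj x y -> adj (f x) (f y).

Definition connected (G : graph) : Prop :=
  (exists x : G, True) /\
  forall x y : G, exists2 p : seq G, path (@adj G) x p & last x p = y.

(* [ucycle] also holds of the empty sequence and of [:: x; y] for an edge xy,
   which are not cycles of a simple graph; hence the length bound. *)
Definition acyclic (G : graph) : Prop :=
  forall c : seq G, 3 <= size c -> ~ ucycle (@adj G) c.

Definition is_tree (G : graph) : Prop := connected G /\ acyclic G.

Definition infinite_graph (G : graph) : Prop := infinite_set [set: G].

Definition neighbours (G : graph) (x : G) : set G := [set y | adj x y].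

(* The maximum degree is exactly k; `I_k is the set of naturals below k. *)
Definition has_max_degree (G : graph) (k : nat) : Prop :=
  (forall x : G, neighbours x #<= `I_k) /\
  (exists x : G, neighbours x #= `I_k).

(* Main.v *)
(** If the tree [Y] arises from the tree [X] by replacing an edge [va] with an edge [vp], where [p]
    lies on the same side of [va] as [a], then [X - v] and [Y - v] are isomorphic.  So it is enough
    that for every vertex [v] of [T], the tree [S] is [T] with one edge at [v] moved in this way, and
    conversely; the resulting injections [T -> S] and [S -> T] combine to a bijection as in the
    Cantor-Bernstein theorem.

    Such a pair is obtained from countably many requirements "[Y] is [X] with the edge [v_m a_m]
    moved", [X] being [T] for odd [m] and [S] for even [m].  Both trees have the same vertices:
    reduced words [m_1 ... m_k] in the free product of countably many groups Z/2, together with a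
    vertex of a core (a finite base tree, or a long path called the [m]-th spine).  The generator [m]
    acts on the vertices as an involution, which is to map [X] to [Y] up to the moved edge; adjacency
    is then defined by recursion on words.  Geometrically, each tree has a trunk starting at its root
    to which the spines are attached in order, and spine [m] joins the tree to a copy of the other
    one.  The new end [p] of the moved edge is the tip of a long dead-end path at spine [m].

    For the lack of embeddings, count the vertices in balls.  The root of [T] has nine vertices
    within distance 2, the root of [S] thirteen within distance 3, and no other vertex of a core
    has as many.  Removing a letter from a word does not decrease the size of small balls, because
    spines are long, so the comparison with the root extends to all vertices by induction on words.
    When the letter [m] takes a root to its copy in the other tree, the [m]-th moved edge is
    missing near the copy, and this deficit shows in the ball reaching that edge. *)

From mathcomp Require Import all_boot.
From mathcomp Require Import boolp classical_sets functions cardinality.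
From mathcomp Require Import zify.
Require Import Defs.

Set Implicit Arguments.
Unset Strict Implicit.
Unset Printing Implicit Defensive.

(** * Spines *)

(* Spine [m] is a path [0, ..., spine_len m], with a dead-end path [spine_len m + 1, ..., tip m]
   attached to the vertex [spine_len m - 5].  In the tree [odd m] it is traversed from [0], in the
   other tree from [spine_len m]. *)
Definition spine_len m := 4 * m + 20.
Definition stub_len m := 2 * m + 8.
Definition tip m := spine_len m + stub_len m.

Ltac lens_lia := unfold tip, spine_len, stub_len in *; lia.

Definition spine_nbrs m i :=
  if i == 0 then [:: 1]
  else if i < spine_len m then [:: i.-1;
    i.+1] ++ (if i == spine_len m - 5 then [:: (spine_len m).+1] else [::])
  else if i == spine_len m then [:: i.-1]
  else (if i == (spine_len m).+1 then spine_len m - 5 else i.-1) :: (if i < tip m then [::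
    i.+1] else [::]).

(** Distance from the end [endp s m] at which the tree [s] enters the spine. The stub branches off
    at distance [spine_len m - 5] from one end and 5 from the other. *)
Definition spine_dist (s : bool) m i :=
  if s == odd m then (if i <= spine_len m then i else spine_len m - 5 + (i - spine_len m))
  else (if i <= spine_len m then spine_len m - i else 5 + (i - spine_len m)).

Definition spine_par (s : bool) m i :=
  if i == (spine_len m).+1 then spine_len m - 5
  else if (s == odd m) || (spine_len m < i) then i.-1 else i.+1.

Definition endp (s : bool) m := if s == odd m then 0 else spine_len m.
(** For [m = 0] the hub is the root itself, so that the trunk reads root, entry 1, hub 1, entry 2,
    hub 2, and so on. *)
Definition hub (s : bool) m :=
  if m == 0 then 0 else if s == odd m then 1 else (spine_len m).-1.

Lemma mem_spine_nbrs m i (j : nat) : i <= tip m -> (j \in spine_nbrs m i) = (j <= tip m) &&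
  [|| (j == i.+1) && (i != spine_len m), (i == j.+1) && (j != spine_len m),
      (i == spine_len m - 5) && (j == (spine_len m).+1) |
        (j == spine_len m - 5) && (i == (spine_len m).+1)].
Proof. by move=> ?; rewrite /spine_nbrs; repeat (case: ifP => ? //=); rewrite ?inE ?in_nil;
  lens_lia. Qed.

Lemma spine_nbrs_le m i j : i <= tip m -> j \in spine_nbrs m i -> j <= tip m.
Proof. by move=> ?; rewrite mem_spine_nbrs // => /andP[]. Qed.

Lemma spine_nbrs_sym m i j : i <= tip m -> j \in spine_nbrs m i -> i \in spine_nbrs m j.
Proof. by move=> li lj; have le := spine_nbrs_le li lj; move: lj; rewrite !mem_spine_nbrs //;
  lens_lia. Qed.

Lemma spine_nbrs_uniq m i : uniq (spine_nbrs m i).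
Proof. by rewrite /spine_nbrs; repeat (case: ifP => ? //=; rewrite ?inE //=); lens_lia. Qed.

Lemma spine_nbrs_dist s m i j : i <= tip m -> j \in spine_nbrs m i ->
  [/\ spine_dist s m j = (spine_dist s m i).+1, spine_par s m j = i & j != endp s m] \/
  [/\ spine_dist s m i = (spine_dist s m j).+1, spine_par s m i = j & i != endp s m].
Proof.
move=> li; rewrite mem_spine_nbrs // /spine_dist /spine_par /endp => /andP[lj H].
have : (j == i.+1) && (i != spine_len m) || ((i == spine_len m - 5) && (j == (spine_len m).+1)) ||
  ((i == j.+1) && (j != spine_len m) || (j == spine_len m - 5) && (i == (spine_len m).+1)) by lia.
clear H; case: (s == odd m) => /orP H.
  case: H => H; [left|right]; split; repeat case: ifP => ?; lens_lia.
case: H => H.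
  have [h|h] := leqP j (spine_len m); [right|left]; split; repeat case: ifP => ?; lens_lia.
have [h|h] := leqP i (spine_len m); [left|right]; split; repeat case: ifP => ?; lens_lia.
Qed.

Lemma spine_par_nbrs s m i : i <= tip m -> i != endp s m -> spine_par s m i \in spine_nbrs m i.
Proof.
by move=> li; rewrite mem_spine_nbrs // /spine_par /endp; case: (s == odd m);
  repeat case: ifP => ?; lens_lia.
Qed.

Lemma spine_dist_par s m i : i <= tip m -> i != endp s m ->
  spine_dist s m i = (spine_dist s m (spine_par s m i)).+1.
Proof.
move=> li; rewrite /spine_dist /spine_par /endp; case: (s == odd m) => /=.
  by case: (i =P (spine_len m).+1) => [->|?] ?; repeat case: ifP => ?; lens_lia.
by case: (i =P (spine_len m).+1) => [->|?] ?; [|case: (ltnP (spine_len m) i) => ?];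
  repeat case: ifP => ?; lens_lia.
Qed.

Lemma spine_dist_endp s m : spine_dist s m (endp s m) = 0.
Proof. by rewrite /spine_dist /endp; case: (s == odd m) => //; case: ifP => ?; lens_lia. Qed.

Lemma spine_dist_hub s m : 0 < m -> spine_dist s m (hub s m) = 1.
Proof.
by rewrite /spine_dist /hub; case: (m =P 0) => [->|_] // m0; case: (s == odd m);
  case: ifP => ?; lens_lia.
Qed.

(** * Base trees *)

(* The two base trees have equally many vertices, so that both trees can live on the same words. *)
Definition base_par (s : bool) i :=
  nth 0 (if s then [:: 0; 0; 0; 1; 1; 2; 2; 3; 7] else [:: 0; 0; 0; 1; 2; 3; 3; 4; 4]) i.
Definition base_dep (s : bool) i :=
  nth 0 (if s then [:: 0; 1; 1; 2; 2; 2; 2; 3; 4] else [:: 0; 1; 1; 2; 2; 3; 3; 3; 3]) i.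
Definition base_nbrs s i :=
  (if i == 0 then [::] else [:: base_par s i]) ++ [seq j <- iota 1 8 | base_par s j == i].

Lemma base_ind (P : nat -> Prop) :
  P 0 -> P 1 -> P 2 -> P 3 -> P 4 -> P 5 -> P 6 -> P 7 -> P 8 -> forall i, i < 9 -> P i.
Proof. by move=> ? ? ? ? ? ? ? ? ?; do 9 (case=> [//|]). Qed.

Lemma base_nbrs_uniq s i : i < 9 -> uniq (base_nbrs s i).
Proof. by case: s; move: i; apply: base_ind. Qed.

Lemma base_nbrs_lt s i (j : nat) : i < 9 -> j \in base_nbrs s i -> j < 9.
Proof. by case: s; move: i; apply: base_ind; rewrite /base_nbrs /base_par /= ?inE ?in_nil; lia. Qed.

Lemma base_nbrs_sym s i (j : nat) : i < 9 -> j \in base_nbrs s i -> i \in base_nbrs s j.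
Proof.
by case: s; move: i; apply: base_ind; rewrite /base_nbrs /base_par /= ?inE ?in_nil => H;
  repeat (case/orP: H => [/eqP -> //|H]); move/eqP: H => ->.
Qed.

Lemma base_nbrs_dep s i (j : nat) : i < 9 -> j \in base_nbrs s i ->
  [/\ base_dep s i < base_dep s j, base_par s j = i & j != 0] \/
  [/\ base_dep s j < base_dep s i, base_par s i = j & i != 0].
Proof.
by case: s; move: i; apply: base_ind; rewrite /base_nbrs /base_par /= ?inE ?in_nil => H;
  repeat (case/orP: H => [/eqP ->|H]); try move/eqP: H => ->; try (by left); by right.
Qed.

Lemma base_par_nbrs s i : i < 9 -> i != 0 -> base_par s i \in base_nbrs s i.
Proof. by case: s; move: i; apply: base_ind. Qed.

Lemma base_dep_par s i : i < 9 -> i != 0 -> base_dep s (base_par s i) < base_dep s i.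
Proof. by case: s; move: i; apply: base_ind. Qed.

(** * Words *)

(* The word [m_1 ... m_k] and a core vertex [(k, i)]: number [i] in the base tree if [k] is zero, in
   spine [k] otherwise.  Spine [m] is fixed pointwise by the generator [m], so the last letter of a
   word ending in spine [m] is not [m]; [level] makes this uniform with the reducedness of words. *)
Definition raw := (seq nat * (nat * nat))%type.

Definition level (x : raw) := if x.1 is m :: _ then m else x.2.1.
Definition flip m (x : raw) : raw :=
  if level x == m then (behead x.1, x.2) else (m :: x.1, x.2).

Definition core_ok (c : nat * nat) := if c.1 == 0 then c.2 < 9 else c.2 <= tip c.1.
Fixpoint wf_word w c :=
  if w is m :: w' then [&& 0 < m, level (w', c) != m & wf_word w' c] else core_ok c.
Definition wf (x : raw) := wf_word x.1 x.2.

Definition core m i : raw := ([::], (m, i)).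
Definition root := core 0 0.
Definition entry s m := core m (endp s m).
Definition hubv s m := core m (hub s m).

Definition trunk s (x : raw) := (x.1 == [::]) &&
  (if x.2.1 == 0 then x.2.2 == 0 else (x.2.2 == endp s x.2.1) || (x.2.2 == hub s x.2.1)).
Definition next s (x : raw) :=
  if x.2.1 == 0 then entry s 1
  else if x.2.2 == endp s x.2.1 then hubv s x.2.1 else entry s x.2.1.+1.

(* [dep] decreases along parents, but is not the distance to the root.  In the copy of the tree
   [~~ s] beyond spine [m], the initial part of the trunk is reversed. *)
Definition flip_dep m := 12 * m + 60.
Definition flip_rho m := 4 * m + 14.

Fixpoint dep_word w s (c : nat * nat) :=
  if w is m :: w' then
    let z := (w', c) in
    if trunk (~~ s) z && (level z < m) then flip_dep m - dep_word w' (~~ s) c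
    else flip_dep m + dep_word w' (~~ s) c
  else if c.1 == 0 then base_dep s c.2 else (2 * c.1).-1 + spine_dist s c.1 c.2.
Definition dep s (x : raw) := dep_word x.1 s x.2.

(* A 1-Lipschitz function bounding the radius of the balls that have to be considered. *)
Fixpoint rho_word w s (c : nat * nat) :=
  if w is m :: w' then maxn (flip_rho m) (rho_word w' (~~ s) c)
  else if c.1 == 0 then 3 else minn (flip_rho c.1) (2 * c.1 + 2 + spine_dist s c.1 c.2).
Definition rho s (x : raw) := rho_word x.1 s x.2.

(* The vertex [moved m] of the tree [odd m] loses the edge to its neighbour [anchor m] on the way to
   spine [m].  The bounds hold for all large [m], so every vertex is moved at some stage. *)
Definition movable m (x : raw) :=
  [&& wf x, level x < m, dep (odd m) x <= m, rho (odd m) x <= m + 3 & x != hubv (odd m) m.-1].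
(** The lowest bit of [m] selects the tree, and [m./2] codes a list headed by the code of a vertex;
    further entries pad the code to make [m] large. The default [core 0 1] is movable at every
    positive stage. *)
Definition moved m : raw :=
  if unpickle (head 0 (CodeSeq.decode m./2)) is Some x then
    if movable m x then x else core 0 1
  else core 0 1.

Lemma moved_movable m : 0 < m -> movable m (moved m).
Proof.
move=> m0; have d : movable m (core 0 1).
  by rewrite /movable /wf /dep /rho /hubv /hub /=; case: (odd m) => //=;
    case: m m0 => [//|[|m]] _ //=; rewrite ?eqE /= ?eqE /=; lia.
by rewrite /moved; case: unpickle => // x; case: ifP.
Qed.

(** The padding [N] makes the code, hence the stage, exceed all bounds in [movable], for either
    parity. *)
Lemma moved_onto (b : bool) x : wf x -> exists m, [/\ 0 < m, odd m = b, moved m = x & level x < m].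
Proof.
move=> wx.
pose N := dep true x + dep false x + rho true x + rho false x + level x + 2.
pose k := CodeSeq.code [:: pickle x; N].
exists (b + k.*2).
have Nk : N < k by have := CodeSeq.ltn_code [:: pickle x; N]; rewrite -/k /=; lia.
have -> : odd (b + k.*2) = b by case: (b); rewrite /= ?odd_double.
split => //; try lia.
have -> : moved (b + k.*2) = if movable (b + k.*2) x then x else core 0 1.
  have -> : moved (b + k.*2) = if unpickle (head 0 (CodeSeq.decode (b + k.*2)./2)) is Some x then
    if movable (b + k.*2) x then x else core 0 1 else core 0 1 by [].
  by rewrite half_bit_double CodeSeq.codeK /= pickleK.
rewrite /movable wx /=.
have -> /= : level x < b + k.*2 by lia.
have -> /= : dep (odd (b + k.*2)) x <= b + k.*2 by rewrite /N in Nk; case: (odd _); lia.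
have -> /= : rho (odd (b + k.*2)) x <= b + k.*2 + 3 by rewrite /N in Nk; case: (odd _); lia.
case: eqP => // e; have : level x = (b + k.*2).-1 by rewrite e.
by rewrite /N in Nk; lia.
Qed.

Opaque moved.

(** * Parents and neighbours *)

(** In the copy of the tree [~~ s] beyond spine [m], parents head for spine [m]: outwards along the
    trunk below level [m], towards the root elsewhere. The moved vertex hangs from the tip
    instead. *)
Fixpoint par_word w s (c : nat * nat) : raw :=
  if w is m :: w' then
    let z := (w', c) in
    if (s != odd m) && (z == moved m) then core m (tip m)
    else flip m (if trunk (~~ s) z && (level z < m) then next (~~ s) z else par_word w' (~~ s) c)
  else if c.1 == 0 then core 0 (base_par s c.2)
  else if c.2 == endp s c.1 then hubv s c.1.-1 else core c.1 (spine_par s c.1 c.2).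
Definition par s (x : raw) := par_word x.1 s x.2.

(** The parent of [z] after re-rooting the tree [s] at spine [m]. *)
Definition toward m s z := if trunk s z && (level z < m) then next s z else par s z.

Definition anchor m := toward m (odd m) (moved m).

Definition link (b : bool) m y := if b then y else flip m y.

(** Spine [m] meets the trunk of the tree [odd m] at 0 and 1, and that of the tree [~~ odd m] at
    [spine_len m] and its predecessor. In the tree [s] one of these trunks is its own, the other one
    appears flipped. *)
Definition links s m i : seq raw :=
  if i == 0 then [:: link (s == odd m) m (hubv (odd m) m.-1)]
  else if i == 1 then [:: link (s == odd m) m (entry (odd m) m.+1)]
  else if i == (spine_len m).-1 then [:: link (s != odd m) m (entry (~~ odd m) m.+1)]
  else if i == spine_len m then [:: link (s != odd m) m (hubv (~~ odd m) m.-1)]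
  else if (i == tip m) && (s != odd m) then [:: flip m (moved m)]
  else [::].

Definition nbrs_core s (c : nat * nat) : seq raw :=
  if c.1 == 0 then map (core 0) (base_nbrs s c.2) ++ (if c.2 == 0 then [:: entry s 1] else [::])
  else map (core c.1) (spine_nbrs c.1 c.2) ++ links s c.1 c.2.

(* In the tree [~~ odd m], the edge [moved m -- anchor m] becomes [moved m -- tip m]. *)
Definition transport m s (z y : raw) : raw :=
  if [&& s != odd m, z == moved m & y == anchor m] then core m (tip m) else flip m y.
Definition kept m s (z y : raw) := ~~ [&& s != odd m, z == anchor m & y == moved m].

Fixpoint nbrs_word w s (c : nat * nat) : seq raw :=
  if w is m :: w' then
    [seq transport m s (w', c) y | y <- nbrs_word w' (~~ s) c & kept m s (w', c) y]
  else nbrs_core s c.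
Definition nbrs s (x : raw) := nbrs_word x.1 s x.2.

(** * Flips of reduced words, and the descent to the root *)

Lemma wf_core k i : wf (core k i) = core_ok (k, i). Proof. by []. Qed.

Lemma flip_core m i : flip m (core m i) = core m i.
Proof. by rewrite /flip /level /= eqxx. Qed.

Lemma flip_cons m z : level z != m -> flip m z = (m :: z.1, z.2).
Proof. by rewrite /flip => /negbTE->. Qed.

Lemma flipK m x : wf x -> flip m (flip m x) = x.
Proof.
case: x => [[|k w] [j i]]; rewrite /wf /flip /level /=.
  by case: (eqVneq j m) => [->|ne] /=; rewrite eqxx.
case/and3P=> _ ne _; case: (eqVneq k m) => [e|_] /=; last by rewrite eqxx.
by move: ne; rewrite e /level /= => /negbTE ->.
Qed.

Lemma flip_wf m x : 0 < m -> wf x -> wf (flip m x).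
Proof.
case: x => [[|k w] [j i]] m0; rewrite /wf /flip /level /=.
  by case: (eqVneq j m) => [->|ne] /= h; rewrite ?h ?m0 // /level /= ne.
case/and3P=> k0 ne h; case: (eqVneq k m) => [e|nk] //=.
by rewrite m0 k0 h /= -/(level (w, (j, i))) ne /level /= nk.
Qed.

Lemma flip_inj m x y : wf x -> wf y -> flip m x = flip m y -> x = y.
Proof. by move=> wx wy e; rewrite -(flipK m wx) e flipK. Qed.

Lemma level_flip m z : level z != m -> level (flip m z) = m.
Proof. by move=> h; rewrite flip_cons. Qed.

(** Induction on words in terms of [flip], which prepends [m] when the level is not [m]; the shorter
    word is read in the opposite tree. *)
Lemma raw_ind (P : bool -> raw -> Prop) :
  (forall s i, i < 9 -> P s (core 0 i)) ->
  (forall s k i, 0 < k -> i <= tip k -> P s (core k i)) ->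
  (forall s m z, 0 < m -> wf z -> level z != m -> P (~~ s) z -> P s (flip m z)) ->
  forall s x, wf x -> P s x.
Proof.
move=> H0 H1 H2 s [w [k i]]; elim: w s => [|m w IH] s.
  rewrite wf_core /core_ok /=; case: posnP => [->|k0]; [exact: H0|exact: H1].
case/and3P => m0 ne wz; have := @H2 s m (w, (k, i)) m0 wz ne (IH _ wz).
by rewrite flip_cons.
Qed.

Lemma level_hubv s k : level (hubv s k) = k. Proof. by []. Qed.
Lemma level_entry s k : level (entry s k) = k. Proof. by []. Qed.

Lemma flip_neq_root m z : level z != m -> flip m z != root.
Proof. by move=> h; rewrite flip_cons //; apply/eqP => -[]. Qed.

Lemma nbrs_flip m s z : level z != m ->
  nbrs s (flip m z) = [seq transport m s z y | y <- nbrs (~~ s) z & kept m s z y].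
Proof. by move=> h; rewrite flip_cons //; case: z h. Qed.

Lemma par_flip m s z : level z != m ->
  par s (flip m z) = if (s != odd m) && (z == moved m) then core m (tip m) else flip m (toward
    m (~~ s) z).
Proof. by move=> h; rewrite flip_cons //; case: z h. Qed.

Lemma dep_flip m s z : level z != m ->
  dep s (flip m z) = if trunk (~~ s) z && (level z < m) then flip_dep m - dep (~~ s) z
                   else flip_dep m + dep (~~ s) z.
Proof. by move=> h; rewrite flip_cons //; case: z h. Qed.

Lemma rho_flip m s z : level z != m -> rho s (flip m z) = maxn (flip_rho m) (rho (~~ s) z).
Proof. by move=> h; rewrite flip_cons //; case: z h. Qed.

Lemma nbrs_base s i : nbrs s (core 0 i) = map (core 0) (base_nbrs s i) ++ (if i == 0 then [::
  entry s 1] else [::]).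
Proof. by []. Qed.

Lemma nbrs_spine s k i : 0 < k -> nbrs s (core k i) = map (core k) (spine_nbrs k i) ++ links s k i.
Proof. by case: k. Qed.

Lemma core_inj k : injective (core k).
Proof. by move=> i j []. Qed.

Lemma endp_le s m : endp s m <= tip m.
Proof. by rewrite /endp; case: ifP => _; lens_lia. Qed.

Lemma hub_le s m : hub s m <= tip m.
Proof. by rewrite /hub; repeat case: ifP => _; lens_lia. Qed.

Lemma wf_entry s k : 0 < k -> wf (entry s k).
Proof. by case: k => // k _; rewrite wf_core /core_ok /= endp_le. Qed.

Lemma wf_hubv s k : wf (hubv s k).
Proof. by rewrite wf_core /core_ok /=; case: k => [|k] //=; rewrite hub_le. Qed.

Lemma endp_hub s m : 0 < m -> (hub s m == endp s m) = false.
Proof. by case: m => // m _; rewrite /hub /endp /=; case: ifP => _; lens_lia. Qed.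

Lemma trunkP s x : trunk s x -> (exists k, x = hubv s k) \/ (exists k, x = entry s k.+1).
Proof.
case: x => [[|//] [k i]]; rewrite /trunk /=; case: posnP => [->|k0] /=.
  by move/eqP->; left; exists 0.
by case/orP=> /eqP ->; [right; exists k.-1; rewrite prednK|left; exists k].
Qed.

Lemma trunk_hubv s k : trunk s (hubv s k).
Proof. by rewrite /trunk /=; case: k => [|k] //=; rewrite eqxx orbT. Qed.

Lemma trunk_entry s k : trunk s (entry s k.+1).
Proof. by rewrite /trunk /= eqxx. Qed.

Lemma next_hubv s k : next s (hubv s k) = entry s k.+1.
Proof. by rewrite /next /=; case: k => [|k] //=; rewrite endp_hub. Qed.

Lemma next_entry s k : next s (entry s k.+1) = hubv s k.+1.
Proof. by rewrite /next /= eqxx. Qed.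

Lemma par_entry s k : par s (entry s k.+1) = hubv s k.
Proof. by rewrite /par /= eqxx. Qed.

Lemma par_hubv s k : par s (hubv s k.+1) = entry s k.+1.
Proof.
rewrite /par /= endp_hub // /entry /spine_par /hub /endp /=; congr core.
by case: (s == ~~ odd k) => /=; repeat case: ifP => ?; lens_lia.
Qed.

Lemma dep_hubv s k : dep s (hubv s k) = 2 * k.
Proof.
rewrite /dep /=; case: k => [|k] /=; first by case: s.
by rewrite spine_dist_hub //; lia.
Qed.

Lemma dep_entry s k : dep s (entry s k.+1) = (2 * k).+1.
Proof. by rewrite /dep /= spine_dist_endp; lia. Qed.

Lemma spine_dist_le s m i : i <= tip m -> spine_dist s m i <= tip m.
Proof. by rewrite /spine_dist => ?; case: (s == odd m); case: ifP => ?; lens_lia. Qed.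

Lemma moved_facts m : 0 < m ->
  [/\ wf (moved m), level (moved m) < m, dep (odd m) (moved m) <= m,
      rho (odd m) (moved m) <= m + 3 & moved m != hubv (odd m) m.-1].
Proof. by move/moved_movable/and5P. Qed.

Lemma level_moved m : 0 < m -> (level (moved m) == m) = false.
Proof. by case/moved_facts => _ h _ _ _; lia. Qed.

(** Flipped vertices outside spine [m] get level [m], and those on spine [m] are fixed with level
    [m]; hence the level changes only along the trunk. *)
Lemma par_level s x : wf x -> x != root ->
  wf (par s x) /\
  (level (par s x) = level x \/ exists k, x = entry s k.+1 /\ par s x = hubv s k).
Proof.
move=> wx; move: s x wx; apply: raw_ind.
- move=> s i li ni; split; last by left.
  have i0 : i != 0 by apply: contra ni => /eqP ->.
  by rewrite wf_core /core_ok /=; apply: (base_nbrs_lt li (base_par_nbrs s li i0)).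
- move=> s k i k0 li _; rewrite /par /= eqn0Ngt k0 /=.
  case: eqVneq => [->|ne].
    by split; [exact: wf_hubv|right; exists k.-1; rewrite prednK].
  by rewrite wf_core /core_ok /= eqn0Ngt k0 /= (spine_nbrs_le li) ?spine_par_nbrs //;
    split=> //; left.
move=> s m z m0 wz lz IH _; rewrite par_flip // level_flip //; case: ifP => _.
  by rewrite wf_core /core_ok /= eqn0Ngt m0 leqnn; split=> //; left.
have Hc x : wf x -> (level x = m -> exists i, x = core m i) ->
  wf (flip m x) /\ level (flip m x) = m.
  move=> wy h; split; first exact: flip_wf.
  by case: (eqVneq (level x) m) => [/h [i ->]|/level_flip //]; rewrite flip_core.
rewrite /toward; case: ifP => [/andP[/trunkP[[k ->]|[k ->]] lt]|nt].
- rewrite next_hubv; have [|-> ->] := Hc _ (wf_entry (~~ s) (ltn0Sn k)); [by move=> <-;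
  eexists|by split; [|left]].
- rewrite next_entry; have [|-> ->] := Hc _ (wf_hubv (~~ s) k.+1); [by move=> <-;
  eexists|by split; [|left]].
have zr : z != root by apply: contraFN nt => /eqP ->.
have [wp lp] := IH zr; have [|-> ->] := Hc _ wp; last by split; [|left].
case: lp => [-> e|[k [-> ->]] <-]; last by eexists.
by rewrite e eqxx in lz.
Qed.

Lemma par_wf s x : wf x -> x != root -> wf (par s x).
Proof. by move=> wx /(par_level s wx) []. Qed.

Lemma toward_wf m s z : wf z -> (z == root -> 0 < m) -> wf (toward m s z).
Proof.
move=> wz m0; rewrite /toward; case: ifP => [/andP[/trunkP[[k ->]|[k ->]] _]|nt].
- by rewrite next_hubv wf_entry.
- by rewrite next_entry wf_hubv.
apply: par_wf => //; apply: contraFN nt => zr.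
by rewrite (eqP zr) (trunk_hubv _ 0) m0.
Qed.

Lemma dep_core s m i : 0 < m -> i <= tip m -> dep s (core m i) <= 8 * m + 28.
Proof. by case: m => // m _ li; rewrite /dep /=; have := @spine_dist_le s _ _ li; lens_lia. Qed.

(** On the reversed part of the trunk [flip_dep m - dep] decreases outwards, elsewhere
    [flip_dep m + dep] decreases towards the root, and [flip_dep m] is large enough for the last
    step into spine [m]. *)
Lemma dep_toward m s z : 0 < m -> wf z -> level z != m ->
  (z != root -> dep s (par s z) < dep s z) ->
  dep (~~ s) (flip m (toward m s z)) < dep (~~ s) (flip m z).
Proof.
move=> m0 wz lz IH.
rewrite (dep_flip _ lz) negbK /toward; case: ifP => [/andP[/trunkP[[k ->]|[k ->]]]|nt].
- rewrite next_hubv level_hubv dep_hubv => lt; case: (eqVneq k.+1 m) => [e|ne].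
    by rewrite e flip_core; have := @dep_core (~~ s) m _ m0 (endp_le s m); rewrite /flip_dep; lia.
  by rewrite dep_flip // negbK trunk_entry level_entry dep_entry /flip_dep; case: ifP => ?; lia.
- rewrite next_entry level_entry dep_entry => lt.
  rewrite dep_flip ?negbK ?trunk_hubv ?level_hubv ?lt ?dep_hubv /flip_dep /=; lia.
have zr : z != root by apply: contraFN nt => /eqP ->; rewrite (trunk_hubv _ 0).
have [wp [lp|[k [ze pe]]]] := par_level s wz zr.
  by rewrite dep_flip lp // negbK; have := IH zr; case: ifP => _; lia.
subst z; rewrite pe; case: (eqVneq k m) => [->|ne].
  by rewrite flip_core; have := @dep_core (~~ s) m _ m0 (hub_le s m); rewrite /flip_dep; lia.
by rewrite dep_flip // negbK; have := IH isT; rewrite par_entry; case: ifP => _; lia.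
Qed.

Lemma dep_par s x : wf x -> x != root -> dep s (par s x) < dep s x.
Proof.
move=> wx; move: s x wx; apply: raw_ind.
- move=> s i li ni; have i0 : i != 0 by apply: contra ni => /eqP ->.
  exact: base_dep_par.
- move=> s k i k0 li _; rewrite /par /= eqn0Ngt k0 /=.
  case: eqVneq => [->|ne].
    by rewrite dep_hubv -/(entry s k) -(prednK k0) dep_entry /=.
  by rewrite /dep /= eqn0Ngt k0 /= [spine_dist s k i]spine_dist_par //; lia.
move=> s m z m0 wz lz IH _; rewrite par_flip //; case: ifP => [/andP[so /eqP zv]|_].
  have [_ _ dv _ _] := moved_facts m0.
  rewrite dep_flip //; have := @dep_core s m _ m0 (leqnn (tip m)).
  have -> : ~~ s = odd m by case: (s) (odd m) so => [] [].
  by rewrite zv /flip_dep; case: ifP => _; lia.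
by have := @dep_toward m (~~ s) z m0 wz lz IH; rewrite negbK.
Qed.

Lemma side_odd s m : (s != odd m) = (~~ s == odd m).
Proof. by case: s; case: (odd m). Qed.

(** * Tree structure *)

(** The only vertex of level below [m] whose next step enters spine [m] is [hubv (odd m) m.-1],
    which [movable] excludes. *)
Lemma anchor_facts m : 0 < m -> wf (anchor m) /\ level (anchor m) < m.
Proof.
move=> m0; have [wv lv _ _ hv] := moved_facts m0.
split; first by apply: toward_wf.
rewrite /anchor /toward lv andbT; case: ifP => [/trunkP[[k e]|[k e]]|nt].
- rewrite e in lv hv *; rewrite next_hubv level_entry; move: lv; rewrite level_hubv => lv.
  by case: (ltngtP k.+1 m) => // [|e2]; [lia|rewrite -e2 eqxx in hv].
- by rewrite e in lv *; rewrite next_entry level_hubv.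
have nr : moved m != root by apply: contraFN nt => /eqP ->; apply: (trunk_hubv _ 0).
have [_ [->//|[k [e ->]]]] := par_level (odd m) wv nr.
by rewrite e level_entry in lv; rewrite level_hubv; lia.
Qed.

Lemma level_anchor m : 0 < m -> (level (anchor m) == m) = false.
Proof. by case/anchor_facts => _ h; lia. Qed.

(** The [dep] of the flipped vertex drops strictly at each step of [toward], so two steps cannot
    return. *)
Lemma toward_anchor m : 0 < m -> (toward m (odd m) (anchor m) == moved m) = false.
Proof.
move=> m0; apply/eqP => e; have [wv lv _ _ _] := moved_facts m0; have [wa la] := anchor_facts m0.
have h1 := @dep_toward m (odd m) (moved m) m0 wv (negbT (level_moved m0)) (dep_par _ wv).
have h2 := @dep_toward m (odd m) (anchor m) m0 wa (negbT (level_anchor m0)) (dep_par _ wa).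
by rewrite -/(anchor m) in h1; rewrite e in h2; lia.
Qed.

Lemma anchor_neq_moved m : 0 < m -> (anchor m == moved m) = false.
Proof.
move=> m0; apply/eqP => e; have := toward_anchor m0; rewrite e -/(anchor m) e.
by rewrite eqxx.
Qed.

Lemma links_endp s t m : 0 < m -> link (s == t) m (hubv t m.-1) \in links s m (endp t m).
Proof.
move=> m0; rewrite /links /endp; case: (eqVneq t (odd m)) => [->|ne] /=; first by rewrite inE.
have -> : t = ~~ odd m by case: (t) (odd m) ne => [] [].
have -> : (s == ~~ odd m) = (s != odd m) by case: (s); case: (odd m).
do 3 (case: ifP => ?; first lens_lia); by rewrite eqxx inE.
Qed.

Lemma links_hub s t m : 0 < m -> link (s == t) m (entry t m.+1) \in links s m (hub t m).
Proof.
move=> m0; rewrite /links /hub [m == 0]eqn0Ngt m0; case: (eqVneq t (odd m)) => [->|ne] /=;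
  first by rewrite inE.
have -> : t = ~~ odd m by case: (t) (odd m) ne => [] [].
have -> : (s == ~~ odd m) = (s != odd m) by case: (s); case: (odd m).
do 2 (case: ifP => ?; first lens_lia); by rewrite eqxx inE.
Qed.

Lemma links_tip s m : s != odd m -> links s m (tip m) = [:: flip m (moved m)].
Proof.
move=> so; rewrite /links so.
by do 4 (case: ifP => ?; first lens_lia); rewrite eqxx.
Qed.

Lemma linksP s m i y : 0 < m -> y \in links s m i ->
  [\/ exists2 t, i = endp t m & y = link (s == t) m (hubv t m.-1),
      exists2 t, i = hub t m & y = link (s == t) m (entry t m.+1) |
      [/\ s != odd m, i = tip m & y = flip m (moved m)]].
Proof.
move=> m0; rewrite /links.
have e : (s == ~~ odd m) = (s != odd m) by case: (s); case: (odd m).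
have ne : (~~ odd m == odd m) = false by case: (odd m).
case: eqP => [->|_]; first by rewrite inE => /eqP ->; constructor 1; exists (odd m);
  rewrite // /endp eqxx.
case: eqP => [->|_].
  by rewrite inE => /eqP ->; constructor 2; exists (odd m); rewrite // /hub [m == 0]eqn0Ngt m0 eqxx.
case: eqP => [->|_].
  by rewrite inE => /eqP ->; constructor 2; exists (~~ odd m);
    rewrite ?e // /hub [m == 0]eqn0Ngt m0 ne.
case: eqP => [->|_].
  by rewrite inE => /eqP ->; constructor 1; exists (~~ odd m); rewrite ?e // /endp ne.
by case: ifP => // /andP[/eqP -> so]; rewrite inE => /eqP ->; constructor 3.
Qed.

Lemma entry_nbrs s k : hubv s k \in nbrs s (entry s k.+1).
Proof.
rewrite nbrs_spine // mem_cat; apply/orP; right.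
by have := @links_endp s s k.+1 isT; rewrite eqxx.
Qed.

Lemma hubv_nbrs s k : entry s k.+1 \in nbrs s (hubv s k).
Proof.
case: k => [|k]; first by rewrite nbrs_base mem_cat inE eqxx orbT.
rewrite nbrs_spine // mem_cat; apply/orP; right.
by have := @links_hub s s k.+1 isT; rewrite eqxx.
Qed.

Lemma endp_spine_nbrs s m : 0 < m -> hub s m \in spine_nbrs m (endp s m).
Proof.
move=> m0; rewrite mem_spine_nbrs ?endp_le // hub_le /hub /endp eqn0Ngt m0.
by case: ifP => _; lens_lia.
Qed.

Lemma next_nbrs s x : trunk s x -> next s x \in nbrs s x.
Proof.
case/trunkP=> [[k ->]|[k ->]]; first by rewrite next_hubv hubv_nbrs.
by rewrite next_entry nbrs_spine // mem_cat (map_f (core k.+1) (endp_spine_nbrs s (ltn0Sn k))).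
Qed.

Lemma nbrs_flip_odd m s z : level z != m -> s = odd m ->
  nbrs s (flip m z) = map (flip m) (nbrs (~~ s) z).
Proof.
move=> lz ->; rewrite nbrs_flip // (@eq_filter _ _ predT) ?filter_predT.
  by apply: eq_map => y; rewrite /transport eqxx.
by move=> y; rewrite /kept eqxx.
Qed.

Lemma par_nbrs s x : wf x -> x != root -> par s x \in nbrs s x.
Proof.
move=> wx; move: s x wx; apply: raw_ind.
- move=> s i li ni; have i0 : i != 0 by apply: contra ni => /eqP ->.
  by rewrite nbrs_base mem_cat (map_f (core 0) (base_par_nbrs s li i0)).
- move=> s k i k0 li _; rewrite nbrs_spine // mem_cat /par /= eqn0Ngt k0 /=.
  case: eqVneq => [->|ne] /=; last by rewrite (map_f (core k) (spine_par_nbrs li ne)).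
  by apply/orP; right; have := @links_endp s s k k0; rewrite eqxx.
move=> s m z m0 wz lz IH _.
have qnb : toward m (~~ s) z \in nbrs (~~ s) z.
  rewrite /toward; case: ifP => [/andP[/next_nbrs //]|nt].
  by apply: IH; apply: contraFN nt => /eqP ->; rewrite (trunk_hubv _ 0).
rewrite nbrs_flip // par_flip //; case: (boolP (s != odd m)) => so; last first.
  apply/mapP; exists (toward m (~~ s) z); last by rewrite /transport (negbTE so).
  by rewrite mem_filter /kept (negbTE so).
have so' : ~~ s = odd m by apply/eqP; rewrite -side_odd.
case: (eqVneq z (moved m)) => [zv|zv] /=; apply/mapP; exists (toward m (~~ s) z).
- by rewrite mem_filter qnb andbT /kept so zv eq_sym anchor_neq_moved.
- by rewrite /transport so zv so' -/(anchor m) !eqxx.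
- rewrite mem_filter qnb andbT /kept so /= so'.
  by case: eqP => [->|//]; rewrite toward_anchor.
by rewrite /transport (negbTE zv) andbF.
Qed.

Lemma toward_nbrs m s z : wf z -> 0 < m -> toward m s z \in nbrs s z.
Proof.
move=> wz m0; rewrite /toward; case: ifP => [/andP[/next_nbrs //]|nt].
by apply: par_nbrs => //; apply: contraFN nt => /eqP ->; rewrite (trunk_hubv _ 0).
Qed.

Lemma nbrs_anchor m : 0 < m -> anchor m \in nbrs (odd m) (moved m).
Proof. by move=> m0; apply: toward_nbrs => //; case: (moved_facts m0). Qed.

Lemma nbrs_wf s x y : wf x -> y \in nbrs s x -> wf y.
Proof.
move=> wx; move: s x wx y; apply: raw_ind.
- move=> s i li y; rewrite nbrs_base mem_cat => /orP[/mapP[j lj ->]|]; first exact: base_nbrs_lt lj.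
  by case: ifP => // _; rewrite inE => /eqP ->; apply: wf_entry.
- move=> s k i k0 li y; rewrite nbrs_spine // mem_cat => /orP[/mapP[j lj ->]|].
    by rewrite wf_core /core_ok /= eqn0Ngt k0 /= (spine_nbrs_le li).
  case/(linksP k0) => [[t _ ->]|[t _ ->]|[_ _ ->]].
  + by rewrite /link; case: ifP => _; rewrite ?flip_wf ?wf_hubv.
  + by rewrite /link; case: ifP => _; rewrite ?flip_wf ?wf_entry.
  by apply: flip_wf => //; case: (moved_facts k0).
move=> s m z m0 wz lz IH y; rewrite nbrs_flip // => /mapP[u].
rewrite mem_filter => /andP[_ /IH wu ->]; rewrite /transport; case: ifP => _; last exact: flip_wf.
by rewrite wf_core /core_ok /= eqn0Ngt m0 /=.
Qed.

Lemma nbrs_level s x y : wf x -> y \in nbrs s x ->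
  [\/ level y = level x, exists2 k, x = hubv s k & y = entry s k.+1 |
      exists2 k, x = entry s k.+1 & y = hubv s k].
Proof.
move=> wx; move: s x wx y; apply: raw_ind.
- move=> s i li y; rewrite nbrs_base mem_cat => /orP[/mapP[j lj ->]|]; first by constructor 1.
  by case: ifP => // /eqP ->; rewrite inE => /eqP ->; constructor 2; exists 0.
- move=> s k i k0 li y; rewrite nbrs_spine // mem_cat => /orP[/mapP[j lj ->]|];
  first by constructor 1.
  case/(linksP k0) => [[t -> ->]|[t -> ->]|[_ _ ->]].
  + rewrite /link; case: eqP => [->|_]; first by constructor 3; exists k.-1; rewrite ?prednK.
    by constructor 1; rewrite level_flip // level_hubv; lia.
  + rewrite /link; case: eqP => [->|_]; first by constructor 2; exists k.
    by constructor 1; rewrite level_flip // level_entry; lia.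
  by constructor 1; rewrite level_flip // level_moved.
move=> s m z m0 wz lz IH y; rewrite nbrs_flip // => /mapP[u].
rewrite mem_filter => /andP[_ /IH h ->]; constructor 1; rewrite [RHS]level_flip // /transport.
case: ifP => // _; case: (eqVneq (level u) m) => [e|]; last exact: level_flip.
case: h => [h|[k _ h]|[k _ h]]; first by rewrite -h e eqxx in lz.
  by move: e; rewrite h level_entry => <-; rewrite flip_core.
by move: e; rewrite h level_hubv => <-; rewrite flip_core.
Qed.

Lemma nbrs_cross m s z y : wf z -> level z != m -> y \in nbrs s z -> level y = m ->
  [/\ 0 < m, z = hubv s m.-1 & y = entry s m] \/ (z = entry s m.+1 /\ y = hubv s m).
Proof.
move=> wz lz /(nbrs_level wz)[e|[k zk ->]|[k zk ->]] ym; first by rewrite -ym e eqxx in lz.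
  by left; rewrite zk -ym level_entry.
by right; rewrite zk -ym level_hubv.
Qed.

Lemma nbrs_sym s x y : wf x -> y \in nbrs s x -> x \in nbrs s y.
Proof.
move=> wx; move: s x wx y; apply: raw_ind.
- move=> s i li y; rewrite nbrs_base mem_cat => /orP[/mapP[j lj ->]|].
    by rewrite nbrs_base mem_cat map_f // base_nbrs_sym.
  by case: ifP => // /eqP ->; rewrite inE => /eqP ->; apply: (entry_nbrs s 0).
- move=> s k i k0 li y; rewrite nbrs_spine // mem_cat => /orP[/mapP[j lj ->]|].
    by rewrite nbrs_spine // mem_cat map_f // spine_nbrs_sym.
  have nst t : s != t -> t = ~~ s by case: (s) (t) => [] [].
  have [wv lv _ _ hv] := moved_facts k0; have [wa la] := anchor_facts k0.
  case/(linksP k0) => [[t -> ->]|[t -> ->]|[so -> ->]].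
  + rewrite /link -/(entry t k); case: (eqVneq s t) => [->|/nst et].
      by have := hubv_nbrs t k.-1; rewrite prednK.
    rewrite nbrs_flip ?level_hubv; last by lia.
    apply/mapP; exists (entry t k); last first.
      rewrite /transport flip_core; case: ifP => // /and3P[so /eqP e _].
      (* The hub before spine [k] is not [moved k], so its edge to the spine survives the flip. *)
      by move: hv; rewrite -e et; have -> : ~~ s = odd k by [apply/eqP; rewrite -side_odd];
        rewrite eqxx.
    rewrite mem_filter -et; have := hubv_nbrs t k.-1; rewrite prednK // => ->; rewrite andbT.
    by rewrite /kept; case: (entry t k =P moved k) => [e|_];
      [rewrite -e level_entry ltnn in lv|rewrite !andbF].
  + rewrite /link -/(hubv t k); case: (eqVneq s t) => [->|/nst et]; first exact: entry_nbrs.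
    rewrite nbrs_flip ?level_entry; last by lia.
    apply/mapP; exists (hubv t k); last first.
      by rewrite /transport flip_core; case: ifP => // /and3P[_ /eqP e _];
        rewrite -e level_entry in lv; lia.
    rewrite mem_filter -et entry_nbrs andbT.
    by rewrite /kept; case: (hubv t k =P moved k) => [e|_];
      [rewrite -e level_hubv ltnn in lv|rewrite !andbF].
  rewrite nbrs_flip ?level_moved //; apply/mapP; exists (anchor k);
    last by rewrite /transport so !eqxx.
  rewrite mem_filter /kept eq_sym anchor_neq_moved // andbF andbF /=.
  by have -> : ~~ s = odd k; [apply/eqP; rewrite -side_odd|exact: nbrs_anchor].
move=> s m z m0 wz lz IH y; rewrite nbrs_flip // => /mapP[u].
rewrite mem_filter => /andP[kp un] ->; have uz := IH _ un; rewrite /transport.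
case: ifP => [/and3P[so /eqP -> _]|nmv].
  by rewrite nbrs_spine // mem_cat links_tip // inE eqxx orbT.
have [e|lu] := eqVneq (level u) m; last first.
  rewrite nbrs_flip //; apply/mapP; exists z.
    by rewrite mem_filter uz /kept andbT; move: nmv; rewrite [(u == _) && _]andbC => ->.
  rewrite /transport; case: ifP => // /and3P[so uv zv]; move: kp.
  by rewrite /kept so uv zv.
(* Now [u] lies on spine [m], which the flip fixes, and the edge is one of the flipped links of the
   spine. *)
case: (nbrs_cross wz lz un e) => [[_ ze ->]|[ze ->]].
  rewrite flip_core nbrs_spine // mem_cat ze; apply/orP; right.
  by have := @links_endp s (~~ s) m m0; rewrite /link; case: (s).
rewrite flip_core nbrs_spine // mem_cat ze; apply/orP; right.
by have := @links_hub s (~~ s) m m0; rewrite /link; case: (s).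
Qed.

(** Re-rooting at spine [m] only reverses trunk edges, so each edge oriented by [par] is still
    oriented by [toward], one way or the other. *)
Lemma toward_or m s z u : wf z -> wf u ->
  (z != root /\ par s z = u) \/ (u != root /\ par s u = z) ->
  toward m s z = u \/ toward m s u = z.
Proof.
suff H x : wf x -> x != root -> toward m s x = par s x \/ toward m s (par s x) = x.
  move=> wz wu [[nr e]|[nr e]].
    by case: (H z wz nr); rewrite e => ->; [left|right].
  by case: (H u wu nr); rewrite e => ->; [right|left].
move=> wx nr; rewrite {1}/toward; case: ifP => [/andP[/trunkP[[k e]|[k e]] lt]|_]; last by left.
- move: nr lt; rewrite e; case: k {e} => [//|k] _; rewrite level_hubv => lt; right.
  by rewrite par_hubv /toward trunk_entry level_entry lt next_entry.
move: lt; rewrite e level_entry => lt; right.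
by rewrite par_entry /toward trunk_hubv level_hubv (ltnW lt) next_hubv.
Qed.

(** With the decrease of [dep] along parents this excludes cycles. A flipped edge gets its
    orientation from [toward]. *)
Lemma nbrs_par s x y : wf x -> y \in nbrs s x ->
  (x != root /\ par s x = y) \/ (y != root /\ par s y = x).
Proof.
move=> wx; move: s x wx y; apply: raw_ind.
- move=> s i li y; rewrite nbrs_base mem_cat => /orP[/mapP[j lj ->]|].
    by case: (base_nbrs_dep li lj) => [[_ <- ne]|[_ <- ne]]; [right|left]; split=> //;
      apply: contra ne => /eqP[->].
  by case: ifP => // /eqP ->; rewrite inE => /eqP ->; right; rewrite (par_entry s 0).
- move=> s k i k0 li y; rewrite nbrs_spine // mem_cat => /orP[/mapP[j lj ->]|].
    case: (spine_nbrs_dist s li lj) => [[_ e ne]|[_ e ne]]; [right|left];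
      rewrite /par /= eqn0Ngt k0 /= (negbTE ne) e; split=> //; by apply/eqP => -[] k1;
        rewrite k1 in k0.
  have nst t : s != t -> t = ~~ s by case: (s) (t) => [] [].
  have [wv lv _ _ hv] := moved_facts k0.
  case/(linksP k0) => [[t -> ->]|[t -> ->]|[so -> ->]].
  + rewrite /link -/(entry t k); case: (eqVneq s t) => [->|/nst et].
      by left; rewrite -(prednK k0) par_entry.
    right; have lh : level (hubv t k.-1) != k by rewrite level_hubv; lia.
    rewrite flip_neq_root // par_flip // -et; split=> //; case: ifP => [/andP[so /eqP e]|_].
      by move: hv; rewrite -e et; have -> : ~~ s = odd k by [apply/eqP; rewrite -side_odd];
        rewrite eqxx.
    by rewrite /toward trunk_hubv level_hubv prednK // leqnn next_hubv prednK // flip_core.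
  + rewrite /link -/(hubv t k); case: (eqVneq s t) => [->|/nst et]; first by right;
    rewrite par_entry.
    right; have lh : level (entry t k.+1) != k by rewrite level_entry; lia.
    rewrite flip_neq_root // par_flip // -et; split=> //; case: ifP => [/andP[so /eqP e]|_].
      by move: lv; rewrite -e level_entry; lia.
    by rewrite /toward level_entry ltnNge leqnSn andbF par_entry flip_core.
  right; have lh : level (moved k) != k by rewrite level_moved.
  by rewrite flip_neq_root // par_flip // so eqxx.
move=> s m z m0 wz lz IH y; rewrite nbrs_flip // => /mapP[u].
rewrite mem_filter => /andP[kp un] ->; rewrite /transport.
case: ifP => [/and3P[so /eqP e _]|nmv].
  by left; rewrite flip_neq_root // par_flip // so e eqxx.
have [wv lv _ _ hv] := moved_facts m0.
have so' : s != odd m -> ~~ s = odd m by move=> so; apply/eqP; rewrite -side_odd.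
have left_case : toward m (~~ s) z = u -> par s (flip m z) = flip m u.
  move=> e; rewrite par_flip // e; case: ifP => // /andP[so /eqP zv]; move: nmv.
  by rewrite so zv -e zv (so' so) -/(anchor m) !eqxx.
have wu := nbrs_wf wz un.
have [e|lu] := eqVneq (level u) m.
  left; rewrite flip_neq_root // left_case //.
  case: (nbrs_cross wz lz un e) => [[_ -> ->]|[-> ->]].
    by rewrite /toward trunk_hubv level_hubv prednK // leqnn next_hubv prednK.
  by rewrite /toward level_entry ltnNge leqnSn andbF par_entry.
case: (toward_or m wz wu (IH _ un)) => [/left_case|e]; [by left; rewrite flip_neq_root|right].
rewrite flip_neq_root // par_flip // e; split=> //; case: ifP => // /andP[so /eqP uv].
by move: kp; rewrite /kept so uv -e uv (so' so) -/(anchor m) !eqxx.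
Qed.

(** * Degrees, and the flip as an isomorphism off the moved vertex *)

Lemma size_spine_links s k i : size (spine_nbrs k i) + size (links s k i) <= 3.
Proof.
rewrite /spine_nbrs /links.
case: (eqVneq i 0) => [//|i0].
case: (eqVneq i 1) => [->|i1] /=.
  by repeat (case: ifP => ? //=); lens_lia.
by repeat (case: ifP => ? //=); lens_lia.
Qed.

Lemma core_notin_links s k i j : 0 < k -> core k j \notin links s k i.
Proof.
move=> k0; apply/negP => /(linksP k0) [[t _]|[t _]|[_ _]].
- rewrite /link; case: ifP => _; last by rewrite flip_cons // level_hubv; lia.
  by move=> [e _]; lia.
- rewrite /link; case: ifP => _; last by rewrite flip_cons // level_entry; lia.
  by move=> [e _]; lia.
by rewrite flip_cons // level_moved.
Qed.

Lemma tip_notin_nbrs m s z i : wf z -> level z != m -> core m i \in nbrs s z -> i < tip m.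
Proof.
move=> wz lz h; case: (nbrs_cross wz lz h erefl) => [[_ _ [->]]|[_ [->]]].
  by rewrite /endp; case: ifP => _; lens_lia.
by rewrite /hub; repeat case: ifP => _; lens_lia.
Qed.

(** The substituted value, the tip of spine [m], is not the flip of a neighbour: edges from other
    levels enter the spine at an entry or a hub. *)
Lemma transport_inj m s z : 0 < m -> wf z -> level z != m ->
  {in nbrs (~~ s) z &, injective (transport m s z)}.
Proof.
move=> m0 wz lz.
have ct u : u \in nbrs (~~ s) z -> core m (tip m) = flip m u -> False.
  move=> un e; have wu := nbrs_wf wz un; have := congr1 (flip m) e.
  by rewrite flipK // flip_core => e2; move: un; rewrite -e2 => /(tip_notin_nbrs wz lz);
    rewrite ltnn.
move=> u1 u2 n1 n2; rewrite /transport; case: ifP => [/and3P[_ _ /eqP e1]|_];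
  case: ifP => [/and3P[_ _ /eqP e2]|_].
- by rewrite e1 e2.
- by move/(ct _ n2).
- by move/esym/(ct _ n1).
by apply: flip_inj; [exact: nbrs_wf n1|exact: nbrs_wf n2].
Qed.

Lemma nbrs_uniq s x : wf x -> uniq (nbrs s x).
Proof.
move=> wx; move: s x wx; apply: raw_ind.
- move=> s i li; rewrite nbrs_base; have u := base_nbrs_uniq s li.
  rewrite cat_uniq (map_inj_uniq (@core_inj 0)) u /=; case: ifP => //= _; rewrite orbF andbT.
  by apply/mapP => -[j _ []].
- move=> s k i k0 li;
  rewrite nbrs_spine // cat_uniq (map_inj_uniq (@core_inj k)) spine_nbrs_uniq /=.
  apply/andP; split.
    by apply/hasPn => y ly; apply/mapP => -[j _ e]; move: ly;
      rewrite e (negbTE (core_notin_links _ _ _ k0)).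
  by rewrite /links; repeat (case: ifP => _ //=).
move=> s m z m0 wz lz IH; rewrite nbrs_flip // map_inj_in_uniq ?filter_uniq //.
by move=> u1 u2; rewrite !mem_filter => /andP[_ n1] /andP[_ n2]; apply: transport_inj.
Qed.

Lemma size_nbrs s x : wf x -> size (nbrs s x) <= 3.
Proof.
move=> wx; move: s x wx; apply: raw_ind.
- by case; apply: base_ind.
- by move=> s k i k0 li; rewrite nbrs_spine // size_cat size_map size_spine_links.
move=> s m z m0 wz lz IH; rewrite nbrs_flip // size_map size_filter.
exact: leq_trans (count_size _ _) IH.
Qed.

Lemma flip_link m b y : wf y -> flip m (link b m y) = link (~~ b) m y.
Proof. by move=> wy; rewrite /link; case: b => //=; rewrite flipK. Qed.

Lemma core_swap s m i y : 0 < m -> y \in nbrs s (core m i) ->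
  flip m y \in nbrs (~~ s) (core m i) \/ [/\ s != odd m, i = tip m & y = flip m (moved m)].
Proof.
move=> m0; rewrite !nbrs_spine // !mem_cat => /orP[/mapP[j lj ->]|].
  by left; rewrite flip_core map_f.
have e t : ~~ (s == t) = (~~ s == t) by case: (s); case: (t).
case/(linksP m0) => [[t -> ->]|[t -> ->]|]; last by right.
  by left; rewrite flip_link ?wf_hubv // e links_endp ?orbT.
by left; rewrite flip_link ?wf_entry // e links_hub ?orbT.
Qed.

Lemma level_ind (P : raw -> Prop) (m : nat) : 
  (forall x, wf x -> level x != m -> P x) ->
  (forall z, wf z -> level z != m -> P (flip m z)) ->
  (0 < m -> forall i, i <= tip m -> P (core m i)) -> 0 < m ->
  forall x, wf x -> P x.
Proof.
move=> H1 H2 H3 m0 x wx; case: (eqVneq (level x) m) => [e|]; last exact: H1.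
case: x wx e => [[|k w] [j i]] wx; rewrite /level /= => e.
  by rewrite e in wx *; apply: H3 => //; move: wx; rewrite wf_core /core_ok /= eqn0Ngt m0.
rewrite e in wx *; case/and3P: wx => _ lz wz.
by have := H2 (w, (j, i)) wz lz; rewrite flip_cons.
Qed.

(** The old and the new edge both end at the moved vertex or its image, and every other edge is
    respected by the flip. *)
Lemma flip_iso m x y : 0 < m -> wf x -> wf y -> x != moved m -> y != moved m ->
  (flip m y \in nbrs (~~ odd m) (flip m x)) = (y \in nbrs (odd m) x).
Proof.
move=> m0 wx wy; move: x wx; apply: (@level_ind _ m) => // [x wx lx|z wz lz|_ i li] nx ny.
- rewrite nbrs_flip // negbK; apply/mapP/idP => [[u]|h].
    rewrite mem_filter => /andP[_ un]; rewrite /transport (negbTE nx) andbF.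
    by move/(flip_inj wy (nbrs_wf wx un)) ->.
  exists y; last by rewrite /transport (negbTE nx) andbF.
  by rewrite mem_filter h /kept (negbTE ny) !andbF.
- rewrite flipK // (@nbrs_flip_odd m (odd m)) //; apply/idP/mapP => [h|[u un ->]].
    by exists (flip m y); rewrite ?flipK.
  by rewrite flipK //; apply: nbrs_wf un.
rewrite flip_core; apply/idP/idP => /(core_swap m0); rewrite ?negbK ?flipK //.
  by case=> // -[_ _ /(flip_inj wy)] e; rewrite e ?eqxx // in ny; case: (moved_facts m0).
by case=> // -[]; rewrite eqxx.
Qed.

(** * Counting vertices in balls *)

Lemma sumn_inj_le (S T : eqType) (A : seq S) (B : seq T) (F : S -> nat) (G : T ->
  nat) (g : S -> T) :
  uniq A -> {in A &, injective g} ->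
  (forall u, u \in A -> g u \in B /\ F u <= G (g u)) ->
  sumn (map F A) <= sumn (map G B).
Proof.
elim: A B => [|u A IH] B //= /andP[uA UA] gi H.
have [gu Fu] := H u (mem_head _ _).
rewrite (perm_sumn (perm_map G (perm_to_rem gu))) /=; apply: leq_add => //.
apply: IH => // [x y xA yA|x xA]; first by apply: gi; rewrite inE ?xA ?yA orbT.
have [gx Fx] := H x (@mem_behead _ (u :: A) x xA); split=> //.
apply: rem_mem => //; apply: contraNneq uA => e.
by rewrite -(gi x u _ _ e) // inE ?eqxx // xA orbT.
Qed.

Lemma sumn_inj_lt (S T : eqType) (A : seq S) (B : seq T)
    (F : S -> nat) (G : T -> nat) (g : S -> T) y :
  uniq A -> {in A &, injective g} ->
  (forall u, u \in A -> g u \in B /\ F u <= G (g u)) ->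
  y \in B -> 0 < G y -> (forall u, u \in A -> g u = y -> F u < G y) ->
  sumn (map F A) < sumn (map G B).
Proof.
move=> UA gi H yB Gy Hy.
(* Lowering [G] by one at [y] keeps it above [F] but decreases its sum over [B]. *)
have : sumn (map F A) <= sumn (map (fun z => G z - (z == y)) B).
  apply: (sumn_inj_le UA gi) => u uA; have [gB le] := H u uA; split=> //.
  by case: eqP => [e|_]; [have := Hy u uA e; rewrite e; lia|rewrite subn0].
move/leq_ltn_trans; apply.
rewrite !(perm_sumn (perm_map _ (perm_to_rem yB))) /= eqxx.
suff : sumn (map (fun z => G z - (z == y)) (rem y B)) <= sumn (map G (rem y B)) by lia.
elim: (rem y B) => //= z l; lia.
Qed.

Definition away s x0 x : seq raw := [seq y <- nbrs s x | y != x0].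

(* The number of vertices at distance at most [n] from [x] whose path to [x] does not end with the
   edge from [x0]; for [x0 = x] this is the size of the ball. *)
Fixpoint cnt n s x0 x :=
  if n is n'.+1 then (sumn [seq cnt n' s x y | y <- away s x0 x]).+1 else 1.

Lemma cnt_gt0 n s x0 x : 0 < cnt n s x0 x.
Proof. by case: n. Qed.

Lemma cntS n s x0 x : cnt n.+1 s x0 x = (sumn [seq cnt n s x y | y <- away s x0 x]).+1.
Proof. by []. Qed.

Lemma away_uniq s x0 x : wf x -> uniq (away s x0 x).
Proof. by move=> wx; rewrite filter_uniq // nbrs_uniq. Qed.

Lemma nbrs_irr s x : wf x -> (x \in nbrs s x) = false.
Proof.
move=> wx; apply/negP => h.
by have [[nr e]|[nr e]] := nbrs_par wx h; have := dep_par s wx nr; rewrite e ltnn.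
Qed.

Lemma away_self s x : wf x -> away s x x = nbrs s x.
Proof.
move=> wx; apply/all_filterP/allP => y yn; apply: contraTneq yn => ->.
by rewrite nbrs_irr.
Qed.

(* Heading for the end of the trunk, one never gets stuck and never turns back. *)
Definition fwd s x := if trunk s x then next s x else par s x.

Lemma trunk_next s x : trunk s x -> trunk s (next s x).
Proof.
by case/trunkP=> [[k ->]|[k ->]]; rewrite (next_hubv, next_entry) (trunk_entry, trunk_hubv).
Qed.

Lemma dep_next s x : trunk s x -> dep s (next s x) = (dep s x).+1.
Proof.
case/trunkP=> [[k ->]|[k ->]]; first by rewrite next_hubv dep_hubv dep_entry.
by rewrite next_entry dep_entry dep_hubv; lia.
Qed.

Lemma trunk_root s : trunk s root. Proof. exact: (trunk_hubv s 0). Qed.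

Lemma fwd_nbrs s x : wf x -> fwd s x \in nbrs s x.
Proof.
move=> wx; rewrite /fwd; case: ifP => [/next_nbrs //|nt].
by apply: par_nbrs => //; apply: contraFneq nt => ->; apply: trunk_root.
Qed.

Lemma fwd_fwd s x : wf x -> fwd s (fwd s x) != x.
Proof.
move=> wx; rewrite /fwd; case: (boolP (trunk s x)) => [t|nt].
  rewrite trunk_next //; apply: contraTneq (leqnn (dep s x)) => {1}<-.
  by rewrite !dep_next ?trunk_next //; lia.
have nr : x != root by apply: contraNneq nt => ->; apply: trunk_root.
case: ifP => [/trunk_next t|nt2]; first by apply: contraNneq nt => <-.
apply/eqP => e; have := dep_par s wx nr.
have := @dep_par s (par s x) (par_wf s wx nr); rewrite e.
have nr2 : par s x != root by apply: contraFneq nt2 => ->; apply: trunk_root.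
by move/(_ nr2); lia.
Qed.

Lemma fwd_wf s x : wf x -> wf (fwd s x).
Proof. by move=> wx; apply: nbrs_wf (fwd_nbrs s wx). Qed.

Lemma sumn_mem (T : eqType) (l : seq T) (F : T -> nat) y : y \in l -> F y <= sumn (map F l).
Proof. by move=> yl; rewrite (perm_sumn (perm_map F (perm_to_rem yl))) /=; lia. Qed.

Lemma sumn_mem2 (T : eqType) (l : seq T) (F : T -> nat) y z :
  y \in l -> z \in l -> y != z -> F y + F z <= sumn (map F l).
Proof.
move=> yl zl yz; rewrite (perm_sumn (perm_map F (perm_to_rem yl))) /= leq_add2l.
by apply: sumn_mem; apply: rem_mem; rewrite // eq_sym.
Qed.

(** The branch contains a path of [n + 1] vertices running towards the end of the trunk. *)
Lemma cnt_fwd n s x : wf x -> n < cnt n s x (fwd s x).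
Proof.
elim: n x => [//|n IH] x wx; rewrite cntS ltnS.
apply: leq_trans (IH _ (fwd_wf s wx)) _.
apply: (@sumn_mem _ _ (cnt n s (fwd s x))).
by rewrite mem_filter fwd_fwd // fwd_nbrs ?fwd_wf.
Qed.

Lemma hub_inner s k : exists2 j, core k.+1 j \in nbrs s (hubv s k.+1) & core k.+1 j != entry s k.+1.
Proof.
exists (if s == odd k.+1 then 2 else spine_len k.+1 - 2).
  rewrite nbrs_spine // mem_cat map_f // mem_spine_nbrs ?hub_le // /hub.
  have -> : (k.+1 == 0) = false by [].
  by case: (s == odd k.+1); lens_lia.
by apply/eqP => -[]; rewrite /endp; case: (s == odd k.+1); lens_lia.
Qed.

(** Without the hub itself, there remain the forward branch and at least one further vertex inside
    the spine. *)
Lemma cnt_hub n s k : n.+1 < cnt n.+1 s (entry s k.+1) (hubv s k.+1) - 1.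
Proof.
have [j j1 j2] := hub_inner s k; rewrite cntS subn1 /=.
have h1 : entry s k.+2 \in away s (entry s k.+1) (hubv s k.+1).
  by rewrite mem_filter hubv_nbrs andbT; apply/eqP => -[]; lia.
have h2 : core k.+1 j \in away s (entry s k.+1) (hubv s k.+1) by rewrite mem_filter j1 j2.
have ne : entry s k.+2 != core k.+1 j by apply/eqP => -[]; lia.
apply: leq_trans (sumn_mem2 (cnt n s (hubv s k.+1)) h1 h2 ne).
have := @cnt_fwd n s (hubv s k.+1) (wf_hubv _ _); rewrite /fwd trunk_hubv next_hubv.
by have := cnt_gt0 n s (hubv s k.+1) (core k.+1 j); lia.
Qed.

(** A stub entered at its tip has only three vertices within this radius. *)
Lemma cnt_trunk s x : trunk s x -> 3 < cnt 2 s x (next s x).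
Proof.
case/trunkP=> [[k ->]|[k ->]]; last by rewrite next_entry; have := cnt_hub 1 s k; lia.
rewrite next_hubv cntS ltnS.
have h : hubv s k.+1 \in away s (hubv s k) (entry s k.+1).
  rewrite mem_filter -next_entry next_nbrs ?trunk_entry // andbT next_entry.
  by apply/eqP => -[]; lia.
by apply: leq_trans (sumn_mem (cnt 1 s (entry s k.+1)) h); have := cnt_hub 0 s k; lia.
Qed.

(** Going down the stub, [n] steps do not leave it, so only a path is seen. *)
Lemma cnt_tip m s n i : 0 < m -> s != odd m -> spine_len m + n < i -> i <= tip m ->
  cnt n s (if i == tip m then flip m (moved m) else core m i.+1) (core m i) <= n.+1.
Proof.
move=> m0 so; elim: n i => [//|n IH] i li ui.
set x0 := if _ then _ else _.
have nbi : nbrs s (core m i) = [:: core m i.-1; x0].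
  rewrite nbrs_spine // /spine_nbrs /x0; case: ifP => [?|_]; first by lens_lia.
  case: ifP => [?|_]; first by lens_lia.
  case: ifP => [?|_]; first by lens_lia.
  case: ifP => [?|_]; first by lens_lia.
  case: (eqVneq i (tip m)) => [->|ne]; first by rewrite ltnn links_tip.
  rewrite ltn_neqAle ne ui /= /links (negbTE ne).
  by do 4 (case: ifP => [?|_]; first by lens_lia).
have ne : core m i.-1 != x0.
  rewrite /x0; case: ifP => _; first by rewrite flip_cons ?level_moved //; apply/eqP => -[].
  by apply/eqP => -[]; lia.
have e : away s x0 (core m i) = [:: core m i.-1] by rewrite /away nbi /= ne eqxx.
rewrite cntS ltnS e.
rewrite /= addn0; have := IH i.-1.
have -> : (i.-1 == tip m) = false by lia.
by rewrite prednK; [apply; lia|lia].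
Qed.

(** * Comparison of balls around a vertex and around its flip *)

Lemma spine_dist_other_endp s t m : s != t -> spine_dist s m (endp t m) = spine_len m.
Proof.
rewrite /spine_dist /endp; case: (s) (t) (odd m) => [] [] [] //= _; repeat case: ifP => ?; lens_lia.
Qed.

Lemma spine_dist_other_hub s t m : 0 < m -> s != t -> spine_dist s m (hub t m) = (spine_len m).-1.
Proof.
rewrite /spine_dist /hub; case: m => // m _; have -> : (m.+1 == 0) = false by [].
by case: (s) (t) (odd m.+1) => [] [] [] //= _; repeat case: ifP => ?; lens_lia.
Qed.

Lemma spine_dist_tip s m : s != odd m -> spine_dist s m (tip m) = 5 + stub_len m.
Proof. by rewrite /spine_dist => /negbTE ->; repeat case: ifP => ?; lens_lia. Qed.

Lemma spine_dist_tip_ge s m : 5 + stub_len m <= spine_dist s m (tip m).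
Proof. by rewrite /spine_dist; case: (s == odd m); repeat case: ifP => ?; lens_lia. Qed.

Lemma rho_core s m i : 0 < m -> rho s (core m i) = minn (flip_rho m) (2 * m + 2 + spine_dist s m i).
Proof. by case: m. Qed.

Lemma rho_hubv s k : rho s (hubv s k) = 2 * k + 3.
Proof. by case: k => [//|k]; rewrite rho_core // spine_dist_hub // /flip_rho; lia. Qed.

Lemma rho_entry s k : rho s (entry s k.+1) = 2 * k + 4.
Proof. by rewrite rho_core // spine_dist_endp /flip_rho; lia. Qed.

Lemma rho_lip s x y : wf x -> y \in nbrs s x -> rho s x <= (rho s y).+1.
Proof.
move=> wx; move: s x wx y; apply: raw_ind.
- move=> s i li y; rewrite nbrs_base mem_cat => /orP[/mapP[j lj ->] //|].
  by case: ifP => // /eqP ->; rewrite inE => /eqP ->; rewrite rho_entry.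
- move=> s k i k0 li y; rewrite nbrs_spine // mem_cat => /orP[/mapP[j lj ->]|].
    by rewrite !rho_core //; case: (spine_nbrs_dist s li lj) => [[]|[]]; lia.
  have kM : rho s (core k i) <= flip_rho k by rewrite rho_core // geq_minl.
  have big z : level z != k -> rho s (core k i) <= rho s (flip k z).
    by move=> lz; rewrite rho_flip //; lia.
  have kp := prednK k0.
  case/(linksP k0) => [[t ei ->]|[t ei ->]|[_ _ ->]].
  + rewrite /link; case: eqP => [st|_]; last by apply/leqW/big; rewrite level_hubv; lia.
    by rewrite ei -st -/(entry s k) -kp rho_entry rho_hubv; lia.
  + rewrite /link; case: eqP => [st|_]; last by apply/leqW/big; rewrite level_entry; lia.
    by rewrite ei -st -/(hubv s k) rho_entry rho_hubv; lia.
  by apply/leqW/big; rewrite level_moved.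
move=> s m z m0 wz lz IH y; rewrite nbrs_flip // => /mapP[u].
rewrite mem_filter => /andP[_ un] ->; rewrite rho_flip // /transport.
case: ifP => [/and3P[so /eqP -> _]|_].
  (* Both ends of the new edge have value [flip_rho m]: the stub is long, and [rho] is small at the
     moved vertex. *)
  rewrite rho_core //; have := spine_dist_tip_ge s m; have [_ _ _ + _] := moved_facts m0.
  have -> : ~~ s = odd m by apply/eqP; rewrite -side_odd.
  by rewrite /flip_rho; lens_lia.
have ns : s != ~~ s by case: (s).
have [lu|lu] := eqVneq (level u) m; last by rewrite rho_flip //; have := IH _ un; lia.
case: (nbrs_cross wz lz un lu) => [[_ -> ->]|[-> ->]]; rewrite flip_core rho_core //.
  by rewrite rho_hubv spine_dist_other_endp // /flip_rho; lens_lia.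
by rewrite rho_entry spine_dist_other_hub // /flip_rho; lens_lia.
Qed.

(** Excludes the vertices of the copy beyond spine [m], but not the spine itself. *)
Definition inner m (x : raw) := (level x != m) || (x.1 == [::]).

(* [reach] bounds the radius up to which the trees [s] and [~~ s] look alike
   around [x] and [th m x]. *)
Definition reach m K s (x : raw) :=
  if level x == m then K.+1 - spine_dist s m x.2.2 else maxn K (rho s x).

Lemma inner_core m i : inner m (core m i). Proof. by rewrite /inner orbT. Qed.

Lemma innerP m x : wf x -> 0 < m -> inner m x -> level x != m \/ exists2 i, i <= tip m &
  x = core m i.
Proof.
case: x => [[|k' w] [k i]] wx m0; rewrite /inner; last by rewrite orbF; left.
case: (eqVneq (level ([::], (k, i))) m) => [e|]; [right|by left].
move: e wx; rewrite /level /= => -> wx; exists i => //.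
by move: wx; rewrite wf_core /core_ok /= eqn0Ngt m0.
Qed.

Lemma moved_notin_tip m s : 0 < m -> moved m \notin nbrs s (core m (tip m)).
Proof.
move=> m0; have [_ lv _ _ _] := moved_facts m0; apply/negP => h.
have wt : wf (core m (tip m)) by rewrite wf_core /core_ok /= eqn0Ngt m0 /=.
case: (nbrs_level wt h) => [e|[k [ek ei] _]|[k [ek ei] _]].
- by rewrite e ltnn in lv.
- by move: ei; rewrite /hub; repeat case: ifP => _; lens_lia.
by move: ei; rewrite /endp; case: ifP => _; lens_lia.
Qed.

(* The side condition excludes the new edge, which only exists in one of the two trees. *)
Lemma reach_step m K s x y : 0 < m -> 2 * m + 4 <= K -> K <= flip_rho m ->
  wf x -> inner m x -> 0 < reach m K s x -> y \in nbrs s x ->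
  (x = core m (tip m) -> y != flip m (moved m)) ->
  inner m y /\ reach m K s x <= (reach m K s y).+1.
Proof.
move=> m0 K1 K2 wx ix hx yn xt; have mp := prednK m0.
have wy := nbrs_wf wx yn.
case: (innerP wx m0 ix) => [lx|[i li ex]].
  have [ly|ly] := eqVneq (level y) m; last first.
    rewrite /inner ly /reach (negbTE lx) (negbTE ly); split=> //.
    by have := rho_lip wx yn; lia.
  case: (nbrs_cross wx lx yn ly) => [[_ -> ->]|[-> ->]]; rewrite inner_core; split=> //.
    rewrite /reach level_hubv level_entry eqxx; case: eqP => [|_]; first by lia.
    by rewrite spine_dist_endp rho_hubv; lia.
  rewrite /reach level_hubv level_entry eqxx; case: eqP => [|_]; first by lia.
  by rewrite spine_dist_hub // rho_entry; lia.
have lCm j : level (core m j) = m by [].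
move: yn hx xt; rewrite ex /reach lCm eqxx nbrs_spine // mem_cat => /orP[/mapP[j lj ->]|yl] hx xt.
  by rewrite inner_core lCm eqxx; split=> //; case: (spine_nbrs_dist s li lj) => [[]|[]] /=; lia.
case/(linksP m0): yl => [[t ei ey]|[t ei ey]|[so ei ey]]; last by move: (xt (congr1 _ ei));
  rewrite ey eqxx.
(* The links at the opposite end of the spine are out of reach, since [spine_len m] is large
   compared with [K]. *)
- have [st|st] := eqVneq s t; last by move: hx;
  rewrite /= ei spine_dist_other_endp // /flip_rho in K2 *; lens_lia.
  have ly : (level y == m) = false by rewrite ey /link st eqxx level_hubv; lia.
  by rewrite /inner ly; split=> //; lia.
have [st|st] := eqVneq s t; last by move: hx;
  rewrite /= ei spine_dist_other_hub // /flip_rho in K2 *; lens_lia.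
have ly : (level y == m) = false by rewrite ey /link st eqxx level_entry; lia.
by rewrite /inner ly; split=> //; lia.
Qed.

Lemma cut_nbrs m : 0 < m -> flip m (moved m) \notin nbrs (~~ odd m) (flip m (anchor m)).
Proof.
move=> m0; rewrite nbrs_flip ?level_anchor // negbK; apply/mapP => -[y].
rewrite mem_filter /kept eqxx /= => /andP[k yn].
rewrite /transport; case: ifP => _ e; last first.
  have [wv _ _ _ _] := moved_facts m0; have [wa _] := anchor_facts m0.
  by move: k; rewrite -(flip_inj wv (nbrs_wf wa yn) e) eqxx; case: (odd m).
by move: e; rewrite flip_cons ?level_moved.
Qed.

Lemma cut_nbrs_sym m : 0 < m -> flip m (anchor m) \notin nbrs (~~ odd m) (flip m (moved m)).
Proof.
move=> m0; have [wv _ _ _ _] := moved_facts m0; apply: contra (cut_nbrs m0) => h.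
exact: nbrs_sym (flip_wf m0 wv) h.
Qed.

(* Dart [x0 -> x] is not the edge that stage [m] removes from the tree [s]. *)
Definition uncut m (s : bool) (x0 x : raw) :=
  ~~ [&& s == odd m, x0 == moved m & x == anchor m] && ~~ [&& s == odd m, x0 == anchor m &
    x == moved m].

(** Undoes the flip on neighbours of [flip m x], except that the new edge to the tip is traded for
    the lost edge to the anchor. *)
Definition unfold_map m s (x u : raw) :=
  if [&& s == odd m, x == moved m & u == core m (tip m)] then anchor m else flip m u.

Lemma unfold_mapP m K s x0 x u : 0 < m -> wf x -> wf x0 -> 2 * m + 4 <= K ->
  K <= (if s == odd m then stub_len m else flip_rho m) ->
  inner m x -> 0 < reach m K s x -> uncut m s x0 x ->
  u \in away (~~ s) (flip m x0) (flip m x) ->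
  let y := unfold_map m s x u in
  y \in away s x0 x /\
  (u = flip m y /\ flip m y \in nbrs (~~ s) (flip m x) \/
   [/\ s = odd m, x = moved m, y = anchor m & u = core m (tip m)]).
Proof.
move=> m0 wx w0 K1 K2 ix hx uc; rewrite mem_filter => /andP[ux0 un].
have wu : wf u by apply: nbrs_wf un; apply: flip_wf.
have normal y : y \in nbrs s x -> u = flip m y ->
  y \in away s x0 x /\ (u = flip m y /\ flip m y \in nbrs (~~ s) (flip m x)).
  move=> yn e; rewrite -e un mem_filter yn andbT; split=> //.
  by apply: contraNneq ux0 => <-; rewrite e.
rewrite /unfold_map; case: ifP => [/and3P[/eqP so /eqP xv /eqP uC]|nsp].
  split; last by right.
  rewrite mem_filter xv so nbrs_anchor // andbT.
  by move: uc; rewrite /uncut so xv !eqxx andbT /= => /andP[_]; rewrite eq_sym.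
suff h : flip m u \in nbrs s x.
  by have [h1 h2] := normal _ h (esym (flipK m wu)); split=> //; left.
move: ix hx nsp un; case/(innerP wx m0) => [lx|[i li ->]] hx nsp un.
  move: un; rewrite nbrs_flip // negbK => /mapP[y]; rewrite mem_filter => /andP[_ yn] e.
  move: nsp; rewrite e /transport; case: ifP => [/and3P[so -> _]|_ _];
    last by rewrite flipK //; apply: nbrs_wf yn.
  by rewrite eqxx andbT; case: (s) (odd m) so => [] [].
move: un; rewrite flip_core => /(core_swap m0); rewrite negbK => -[//|[so et _]].
(* Here [x] is the tip and [s] is [odd m], so [K] is at most [stub_len m] and the tip is out of
   reach. *)
move: hx; rewrite et /reach eqxx /=; have := spine_dist_tip_ge s m.
by move: K2; rewrite side_odd negbK in so; rewrite so; lia.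
Qed.

(** In the case [s = odd m] the upper bound confines branches entering at the tip to the stub; in
    both cases the far end of the spine stays out of reach. *)
Definition radius_ok m s K := [&& 0 < m, 2 * m + 4 <= K &
  K <= (if s == odd m then stub_len m else flip_rho m)].

Lemma unfold_inj m K s x0 x : radius_ok m s K -> wf x -> wf x0 ->
  inner m x -> 0 < reach m K s x -> uncut m s x0 x ->
  {in away (~~ s) (flip m x0) (flip m x) &, injective (unfold_map m s x)}.
Proof.
move=> /and3P[m0 K1 K2] wx w0 ix hx uc u1 u2 h1 h2 e.
have [_ [[e1 n1]|[s1 x1 y1 ->]]] := unfold_mapP m0 wx w0 K1 K2 ix hx uc h1;
have [_ [[e2 n2]|[s2 x2 y2 ->]]] := unfold_mapP m0 wx w0 K1 K2 ix hx uc h2 => //.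
- by rewrite e1 e2 e.
- by move: n1; rewrite e y2 x2 s2 (negbTE (cut_nbrs_sym m0)).
by move: n2; rewrite -e y1 x1 s1 (negbTE (cut_nbrs_sym m0)).
Qed.

Lemma anchor_fwd m : 0 < m -> anchor m = fwd (odd m) (moved m).
Proof. by move=> m0; have [_ lv _ _ _] := moved_facts m0;
  rewrite /anchor /toward /fwd lv andbT. Qed.

Lemma uncut_step m s x y : 0 < m -> flip m y \in nbrs (~~ s) (flip m x) -> uncut m s x y.
Proof.
move=> m0 h; rewrite /uncut; apply/andP; split; apply/negP => /and3P[/eqP se /eqP xe /eqP ye].
  by move: h; rewrite se xe ye (negbTE (cut_nbrs_sym m0)).
by move: h; rewrite se xe ye (negbTE (cut_nbrs m0)).
Qed.

Definition cnt_le m K s n := forall x0 x, wf x -> wf x0 -> inner m x ->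
  n <= reach m K s x -> uncut m s x0 x ->
  cnt n (~~ s) (flip m x0) (flip m x) <= cnt n s x0 x.

(** A branch through the new edge stays on the stub and has at most [n + 1] vertices, while the
    branch at the anchor heads forward and has at least as many. *)
Lemma unfold_term m K s n x0 x u : radius_ok m s K -> cnt_le m K s n ->
  wf x -> wf x0 -> inner m x -> n < reach m K s x -> uncut m s x0 x ->
  u \in away (~~ s) (flip m x0) (flip m x) ->
  unfold_map m s x u \in away s x0 x /\
  cnt n (~~ s) (flip m x) u <= cnt n s x (unfold_map m s x u).
Proof.
move=> /and3P[m0 K1 K2] IH wx w0 ix hx uc un.
have hx0 : 0 < reach m K s x by apply: leq_ltn_trans hx.
have := unfold_mapP m0 wx w0 K1 K2 ix hx0 uc un.
move: (unfold_map m s x u) => y [yn cs]; split=> //.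
case: cs yn => [[-> h]|[se xe -> ->]].
  rewrite mem_filter => /andP[_ yn].
  have KM : K <= flip_rho m by move: K2; case: ifP => _; rewrite /flip_rho; lens_lia.
  have [|iy hy] := reach_step m0 K1 KM wx ix hx0 yn.
    move=> xt; apply: contraTneq h => ->; rewrite xt flip_core flipK ?moved_notin_tip //.
    by case: (moved_facts m0).
  apply: IH => //; [exact: nbrs_wf yn| |exact: uncut_step].
  by rewrite -ltnS; apply: leq_trans hx hy.
move=> _; have [wv lv dv rv hv] := moved_facts m0.
rewrite xe anchor_fwd // se; apply: leq_trans (cnt_fwd _ _ wv).
have := @cnt_tip m (~~ odd m) n (tip m) m0; rewrite eqxx; apply=> //; first by case: (odd m).
move: hx; rewrite xe /reach (ltn_eqF lv) se; move: K2; rewrite se eqxx; lens_lia.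
Qed.

Lemma unfold_le m K s n : radius_ok m s K -> cnt_le m K s n.
Proof.
move=> rK; elim: n => [//|n IH] x0 x wx w0 ix hx uc; rewrite !cntS ltnS.
apply: (@sumn_inj_le _ _ _ _ _ _ (unfold_map m s x)).
- by apply: away_uniq; apply: flip_wf => //; case/andP: rK.
- by apply: unfold_inj rK wx w0 ix _ uc; apply: leq_ltn_trans hx.
by move=> u un; apply: (unfold_term rK IH wx w0 ix hx uc un).
Qed.

(** A deficit in a single branch [y] survives summation, whether the branch shrinks, disappears, or
    is traded for the stub with its at most [n + 1] vertices. *)
Lemma unfold_lt m K s n x0 x y : radius_ok m s K -> wf x -> wf x0 -> inner m x ->
  n < reach m K s x -> uncut m s x0 x -> y \in away s x0 x ->
  (flip m y \in nbrs (~~ s) (flip m x) -> cnt n (~~ s) (flip m x) (flip m y) < cnt n s x y) ->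
  (s = odd m -> x = moved m -> y = anchor m -> n.+1 < cnt n s x y) ->
  cnt n.+1 (~~ s) (flip m x0) (flip m x) < cnt n.+1 s x0 x.
Proof.
move=> rK wx w0 ix hx uc yn h1 h2; have /and3P[m0 K1 K2] := rK; rewrite !cntS ltnS.
have hx0 : 0 < reach m K s x by apply: leq_ltn_trans hx.
apply: (@sumn_inj_lt _ _ _ _ _ _ (unfold_map m s x) y) => //.
- by apply: away_uniq; apply: flip_wf.
- exact: unfold_inj hx0 uc.
- by move=> u un; apply: (unfold_term rK (@unfold_le m K s n rK) wx w0 ix hx uc un).
- exact: cnt_gt0.
move=> u un; have [_] := unfold_mapP m0 wx w0 K1 K2 ix hx0 uc un => + e; rewrite e.
case=> [[-> //]|[se xe ye ->]]; apply: leq_ltn_trans (h2 se xe ye).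
have [wv lv dv rv hv] := moved_facts m0; rewrite xe.
have := @cnt_tip m (~~ s) n (tip m) m0; rewrite eqxx; apply=> //; first by rewrite se;
  case: (odd m).
move: hx; rewrite xe /reach (ltn_eqF lv) se; move: K2; rewrite se eqxx; lens_lia.
Qed.

(** * Carrying the deficit at the moved edge up to the root *)

Lemma par_root s : par s root = root. Proof. by case: s. Qed.

Lemma par_wf_all s x : wf x -> wf (par s x).
Proof. by move=> wx; case: (eqVneq x root) => [->|/par_wf]; [rewrite par_root|apply]. Qed.

Definition drops m s n x :=
  cnt n (~~ s) (flip m (par s x)) (flip m x) < cnt n s (par s x) x.

Lemma inner_par m s x : 0 < m -> wf x -> x != root -> inner m x -> level x <= m ->
  inner m (par s x) /\ level (par s x) <= m.
Proof.
move=> m0 wx xr ix lx; have [wp lp] := par_level s wx xr.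
split; last by case: lp => [->//|[k [e ->]]]; move: lx; rewrite e level_entry level_hubv; lia.
case: (innerP wx m0 ix) => [nx|[i _ ->]].
  by case: lp => [e|[k [_ ->]]]; rewrite /inner ?e ?nx // orbT.
by rewrite /inner /par /= eqn0Ngt m0 /=; case: ifP => _; rewrite orbT.
Qed.

Lemma dep_coreE s m i : 0 < m -> dep s (core m i) = (2 * m).-1 + spine_dist s m i.
Proof. by case: m. Qed.

(* A deficit at [x] shows, at a correspondingly larger radius, at every ancestor of [x]. *)
Lemma climb m s K n x : radius_ok m s K -> wf x -> inner m x -> level x <= m ->
  (s = odd m -> dep s x < maxn (dep s (moved m)) (dep s (anchor m))) ->
  n + dep s x <= K -> drops m s n x ->
  exists2 n', n' <= K & cnt n' (~~ s) (flip m root) (flip m root) < cnt n' s root root.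
Proof.
move=> rK; have /and3P[m0 K1 K2] := rK.
have [d dx] := ubnP (dep s x); elim: d n x dx => // d IH n x dx wx ix lx cx nK dr.
have [xr|xr] := eqVneq x root.
  by exists n; [lia|move: dr; rewrite /drops xr par_root].
have := dep_par s wx xr; have := par_wf s wx xr.
have := par_nbrs s wx xr; move/(nbrs_sym wx).
have := inner_par s m0 wx xr ix lx; move: dr; rewrite /drops.
move: (par s x) => p dr [ip lp] np wp dp.
have pp : p = root \/ dep s (par s p) < dep s p.
  by case: (eqVneq p root) => [->|/dep_par]; [left|right; auto].
apply: (IH n.+1 p) => //; [lia| |lia|].
  by move=> so; have := cx so; lia.
apply: (@unfold_lt m K s n (par s p) p x) => //.
- exact: par_wf_all.
- case: (innerP wp m0 ip) => [/negbTE nl|[i _ e]]; rewrite /reach; first by rewrite nl; lia.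
  by move: dp; rewrite e eqxx dep_coreE //=; lia.
(* The climb does not use the moved edge: both its ends would have smaller [dep] than [x], against
   [cx]. *)
- rewrite /uncut; apply/andP; split; apply/negP => /and3P[/eqP so /eqP e1 /eqP e2].
    case: pp => [pr|]; last by have := cx so; rewrite -e1 -e2; lia.
    by have := anchor_neq_moved m0; rewrite -e2 -e1 pr par_root eqxx.
  case: pp => [pr|]; last by have := cx so; rewrite -e1 -e2; lia.
  by have := anchor_neq_moved m0; rewrite -e2 -e1 pr par_root eqxx.
- rewrite mem_filter np andbT; apply/eqP => e; case: pp => [pr|]; last by rewrite -e; lia.
  by rewrite e pr par_root eqxx in xr.
by move=> so pv xa; have := cx so; rewrite -pv -xa; lia.
Qed.

Lemma dep_tip m s : 0 < m -> s != odd m -> dep s (core m (tip m)) = 4 * m + 12.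
Proof. by move=> m0 so; rewrite dep_coreE // spine_dist_tip // /stub_len; lia. Qed.

Lemma anchor_cases m : 0 < m ->
  if trunk (odd m) (moved m) then anchor m = next (odd m) (moved m) else anchor m = par (odd m)
    (moved m).
Proof. by move=> m0; rewrite anchor_fwd // /fwd; case: (trunk _ _). Qed.

Lemma par_core s k i : (par s (core k i)).1 = [::].
Proof. by rewrite /par /=; repeat case: ifP => _. Qed.

Lemma dep_par_le s x : wf x -> dep s (par s x) <= dep s x.
Proof. by move=> wx; case: (eqVneq x root) => [->|/(dep_par s wx)/ltnW //]; rewrite par_root. Qed.

(** If [s] is not [odd m], the copy lacks the edge at the tip, whose [dep] is [4 * m + 12], so the
    climb fits into [flip_rho m]. If [s] is [odd m], it lacks the edge at the moved vertex, whose
    [dep] is at most [m], and [stub_len m] suffices. *)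
Lemma root_gap m s : 0 < m -> exists2 n, n <= flip_rho m &
  cnt n (~~ s) (flip m root) (flip m root) < cnt n s root root.
Proof.
move=> m0; have [wv lv dv rv hv] := moved_facts m0; have [wa la] := anchor_facts m0.
have [so|so] := eqVneq s (odd m); last first.
  have rK : radius_ok m s (flip_rho m) by rewrite /radius_ok m0 (negbTE so) leqnn /flip_rho
    andbT; lia.
  have wt : wf (core m (tip m)) by rewrite wf_core /core_ok /= eqn0Ngt m0 /=.
  have vt : flip m (moved m) \in nbrs s (core m (tip m)).
    by rewrite nbrs_spine // mem_cat links_tip // inE eqxx orbT.
  apply: (@climb m s (flip_rho m) 1 (core m (tip m)) rK) => //.
  - exact: inner_core.
  - by move=> e; rewrite e eqxx in so.
  - by rewrite dep_tip // /flip_rho; lia.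
  rewrite /drops; apply: (@unfold_lt m (flip_rho m) s 0 _ _ (flip m (moved m))) => //.
  - exact: par_wf_all.
  - exact: inner_core.
  - by rewrite /reach eqxx /= spine_dist_tip // /flip_rho /stub_len; lia.
  - by rewrite /uncut (negbTE so).
  - rewrite mem_filter vt andbT; apply/eqP => e.
    by have := par_core s m (tip m); rewrite -e flip_cons ?level_moved.
  - by rewrite flip_core flipK // (negbTE (moved_notin_tip _ m0)).
  by move=> e; rewrite e eqxx in so.
have rK : radius_ok m s (stub_len m) by rewrite /radius_ok m0 so eqxx leqnn /stub_len andbT; lia.
have KM : stub_len m <= flip_rho m by rewrite /stub_len /flip_rho; lia.
suff [n nQ dr] : exists2 n, n <= stub_len m &
  cnt n (~~ s) (flip m root) (flip m root) < cnt n s root root.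
  by exists n => //; lia.
have := anchor_cases m0; case: ifP => [tv|ntv] ea.
  have dn := dep_next tv; rewrite -ea in dn.
  (* On the trunk the branch at the anchor, with at least four vertices at radius 2, is replaced by
     a stub with three; this shows at radius 3. *)
  apply: (@climb m s (stub_len m) 3 (moved m) rK) => //.
  - by rewrite /inner level_moved.
  - exact: ltnW.
  - by move=> _; rewrite so; lia.
  - by rewrite so /stub_len; lia.
  rewrite /drops; apply: (@unfold_lt m (stub_len m) s 2 _ _ (anchor m)) => //.
  - exact: par_wf_all.
  - by rewrite /inner level_moved.
  - by rewrite /reach level_moved // /stub_len; lia.
  - rewrite /uncut so eqxx /=; apply/andP; split; apply/negP => /andP[/eqP e1 /eqP e2].
      by have := anchor_neq_moved m0; rewrite -e2 eqxx.
    by have := dep_par_le (odd m) wv; rewrite e1; lia.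
  - rewrite mem_filter so nbrs_anchor // andbT; apply/eqP => e.
    by have := dep_par_le (odd m) wv; rewrite -e; lia.
  - by rewrite so (negbTE (cut_nbrs_sym m0)).
  by move=> _ _ _; rewrite so ea; apply: cnt_trunk.
have vr : moved m != root by apply: contraFneq ntv => ->; apply: trunk_root.
have da : dep (odd m) (anchor m) < dep (odd m) (moved m) by rewrite ea; apply: dep_par.
(* Off the trunk the anchor is the parent and loses a child, which shows at radius 1. *)
apply: (@climb m s (stub_len m) 1 (anchor m) rK) => //.
- by rewrite /inner level_anchor.
- exact: ltnW.
- by move=> _; rewrite so; lia.
- by rewrite so /stub_len; lia.
rewrite /drops; apply: (@unfold_lt m (stub_len m) s 0 _ _ (moved m)) => //.
- exact: par_wf_all.
- by rewrite /inner level_anchor.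
- by rewrite /reach level_anchor // /stub_len; lia.
- rewrite /uncut so eqxx /=; apply/andP; split; apply/negP => /andP[/eqP e1 /eqP e2].
    by have := dep_par_le (odd m) wa; rewrite e1; lia.
  by have := anchor_neq_moved m0; rewrite e2 eqxx.
- rewrite mem_filter so nbrs_sym ?nbrs_anchor // andbT; apply/eqP => e.
  by have := dep_par_le (odd m) wa; rewrite -e; lia.
- by rewrite so (negbTE (cut_nbrs m0)).
by move=> _ e; have := anchor_neq_moved m0; rewrite e eqxx.
Qed.

(** * No vertex imitates a root *)

Lemma size_core s m i : 0 < m -> i != 1 -> i != (spine_len m).-1 -> i != spine_len m - 5 ->
  size (nbrs s (core m i)) <= 2.
Proof.
move=> m0 i1 i2 i3; rewrite nbrs_spine // size_cat size_map /spine_nbrs /links (negbTE i1)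
  (negbTE i2) (negbTE i3).
repeat (case: ifP => ? //=); lens_lia.
Qed.

Lemma size_flip m s x : level x != m -> size (nbrs s (flip m x)) <= size (nbrs (~~ s) x).
Proof. by move=> lx; rewrite nbrs_flip // size_map size_filter count_size. Qed.

Lemma size_away s x y : wf y -> x \in nbrs s y -> (size (away s x y)).+1 = size (nbrs s y).
Proof.
move=> wy xn; have -> : away s x y = rem x (nbrs s y) by rewrite rem_filter // nbrs_uniq.
by rewrite size_rem // prednK //; case: (nbrs s y) xn.
Qed.

Lemma sumn_bound (F : raw -> nat) c (l : seq raw) :
  (forall y, y \in l -> F y <= c) -> sumn (map F l) <= c * size l.
Proof.
elim: l => [|y l IH] H; first by rewrite muln0.
have h1 := H y (mem_head _ _); have : sumn (map F l) <= c * size l.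
  by apply: IH => z zl; apply: H; rewrite inE zl orbT.
by rewrite /= mulnS; lia.
Qed.

Lemma cnt1_le s x y : wf y -> x \in nbrs s y -> cnt 1 s x y <= size (nbrs s y).
Proof.
move=> wy xn; rewrite -(size_away wy xn) cntS ltnS.
by apply: leq_trans (@sumn_bound _ 1 _ _) _ => //; rewrite mul1n.
Qed.

Lemma cnt2_le c s x y : wf y -> x \in nbrs s y -> size (nbrs s y) <= 2 ->
  (forall z, z \in away s x y -> size (nbrs s z) <= c) -> cnt 2 s x y <= c.+1.
Proof.
move=> wy xn sy H; rewrite cntS ltnS.
have sa : size (away s x y) <= 1 by rewrite -ltnS size_away.
apply: leq_trans (@sumn_bound _ c _ _) _; last by nia.
move=> z za; apply: leq_trans (H z za).
move: za; rewrite mem_filter => /andP[_ zy].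
by apply: cnt1_le; [exact: nbrs_wf zy|exact: nbrs_sym].
Qed.

(** The bounds are [1 + 3 * 2] and [1 + 3 + 2 * 4]: at radius 2 the branch at [y0] has at most three
    vertices, the other two at most four each. *)
Lemma cnt_sparse s x y0 : wf x -> (forall y, y \in nbrs s x -> size (nbrs s y) <= 2) ->
  y0 \in nbrs s x -> (forall z, z \in away s x y0 -> size (nbrs s z) <= 2) ->
  cnt 2 s x x <= 7 /\ cnt 3 s x x <= 12.
Proof.
move=> wx H1 y0n H2; have s3 := size_nbrs s wx.
have nbr y : y \in nbrs s x -> wf y /\ x \in nbrs s y.
  by move=> yn; split; [exact: nbrs_wf yn|exact: nbrs_sym].
split.
  rewrite cntS ltnS away_self //; apply: leq_trans (@sumn_bound _ 2 _ _) _; last by lia.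
  by move=> y yn; have [wy xn] := nbr y yn; apply: leq_trans (cnt1_le wy xn) (H1 y yn).
rewrite cntS ltnS away_self // (perm_sumn (perm_map _ (perm_to_rem y0n))) /=.
have [wy xn] := nbr _ y0n; have c0 := cnt2_le wy xn (H1 _ y0n) H2.
apply: leq_trans (leq_add c0 (@sumn_bound _ 4 _ _)) _.
  move=> y /mem_rem yn; have [wy' xn'] := nbr y yn.
  apply: cnt2_le => //; first exact: H1.
  by move=> z; rewrite mem_filter => /andP[_ zy]; apply: size_nbrs; apply: nbrs_wf zy.
have e : @size raw (rem y0 (nbrs s x)) = (@size raw (nbrs s x)).-1 := size_rem y0n.
by rewrite e; move: s3; lia.
Qed.

Lemma cnt_spine s m i : 0 < m -> i <= tip m ->
  size (nbrs s (core m i)) <= 2 \/ cnt 2 s (core m i) (core m i) <= 7 /\ cnt 3 s (core m i)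
    (core m i) <= 12.
Proof.
move=> m0 li.
have wi : wf (core m i) by rewrite wf_core /core_ok /= eqn0Ngt m0.
case: (boolP ((i == 1) || (i == (spine_len m).-1) || (i == spine_len m - 5))) => ci; last first.
  by left; apply: size_core => //; lia.
(* A neighbour on the path. The vertex behind it has degree at most two, as branch vertices of a
   spine are at least four apart. *)
right; pose j := if i == 1 then 2 else i.-1.
have jle : j <= tip m by rewrite /j; case: ifP; lens_lia.
have jn : j \in spine_nbrs m i.
  by rewrite mem_spine_nbrs // jle /j; case: ifP => ?; lens_lia.
have jl : links s m j = [::].
  rewrite /links; have -> : (j == 0) = false by rewrite /j; case: ifP; lens_lia.
  have -> : (j == 1) = false by rewrite /j; case: ifP; lens_lia.
  have -> : (j == (spine_len m).-1) = false by rewrite /j; case: ifP; lens_lia.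
  have -> : (j == spine_len m) = false by rewrite /j; case: ifP; lens_lia.
  by have -> : (j == tip m) = false by rewrite /j; case: ifP; lens_lia.
apply: (@cnt_sparse s _ (core m j)) => //.
- move=> y; rewrite nbrs_spine // mem_cat => /orP[/mapP[k kn ->]|].
    by move: kn; rewrite mem_spine_nbrs // => kn; apply: size_core => //; lens_lia.
  case/(linksP m0) => [[t ei _]|[t ei ->]|[_ ei _]].
  + by move: ci; rewrite ei /endp; case: ifP => _; lens_lia.
  + have se : size (nbrs t (entry t m.+1)) <= 2 by apply: size_core => //; rewrite /endp;
    case: ifP; lens_lia.
    rewrite /link; case: eqP => [->//|ne]; apply: leq_trans (size_flip _ _) _;
      first by rewrite level_entry; lia.
    by have -> : ~~ s = t by case: (s) (t) ne => [] [].
  by move: ci; rewrite ei; lens_lia.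
- by rewrite nbrs_spine // mem_cat map_f.
move=> z; rewrite mem_filter nbrs_spine // jl cats0 => /andP[zi /mapP[k kn ez]].
have ki : k != i by apply: contraNneq zi => <-; rewrite ez.
move: kn; rewrite ez mem_spine_nbrs // => kn; apply: size_core => //.
all: by move: kn ki ci; rewrite /j; case: ifP => ?; lens_lia.
Qed.

Lemma cnt_root_true : cnt 2 true root root = 9. Proof. by vm_compute. Qed.
Lemma cnt_root_false : cnt 3 false root root = 13. Proof. by vm_compute. Qed.
Lemma cnt1_root s : cnt 1 s root root = 4. Proof. by case: s; vm_compute. Qed.

Lemma cnt_base s i : i < 9 ->
  (s && (i == 0) \/ cnt 2 s (core 0 i) (core 0 i) <= 8) /\
  (~~ s && (i == 0) \/ cnt 3 s (core 0 i) (core 0 i) <= 12).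
Proof.
by case: s; move: i; apply: base_ind; split; first [by left | by right; vm_compute].
Qed.

Lemma rho_ge3 s x : wf x -> 3 <= rho s x.
Proof.
move=> wx; move: s x wx; apply: raw_ind => [s i li //|s k i k0 li|s m z m0 wz lz _].
  by rewrite rho_core // /flip_rho; lia.
by rewrite rho_flip // /flip_rho; lia.
Qed.

(** Core vertices are checked directly. Removing a letter keeps the comparison valid up to radius
    [rho], and if it leads to the root of [s] itself, the moved edge supplies the deficit. *)
Lemma gap s s' x : wf x -> ~~ ((s' == s) && (x == root)) ->
  exists2 n, n <= rho s' x & cnt n s' x x < cnt n s root root.
Proof.
move=> wx; move: s' x wx s; apply: raw_ind.
- move=> s' i li s ne; have [b2 b3] := cnt_base s' li.
  have i0 : (core 0 i == root) = (i == 0) by apply/eqP/eqP => [[]|->].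
  rewrite i0 in ne; case: s ne => ne.
    exists 2 => //; rewrite cnt_root_true ltnS; case: b2 => // /andP[s1 i1].
    by rewrite s1 i1 in ne.
  exists 3 => //; rewrite cnt_root_false ltnS; case: b3 => // /andP[s1 i1].
  by rewrite (negbTE s1) i1 in ne.
- move=> s' k i k0 li s _.
  have wi : wf (core k i) by rewrite wf_core /core_ok /= eqn0Ngt k0.
  have r3 := rho_ge3 s' wi.
  case: (cnt_spine s' k0 li) => [sz|[c2 c3]].
    exists 1; first exact: leq_trans r3.
    rewrite cnt1_root cntS away_self // ltnS.
    by apply: leq_ltn_trans (@sumn_bound _ 1 _ _) _ => //; rewrite mul1n.
  case: s; [exists 2; [exact: leq_trans r3|] | exists 3; [exact: r3|]].
    by rewrite cnt_root_true; lia.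
  by rewrite cnt_root_false; lia.
move=> s' m z m0 wz lz IH s _; rewrite rho_flip //.
have [/andP[/eqP e /eqP ->]|ne] := boolP ((~~ s' == s) && (z == root)).
  have [n nM] := root_gap s m0; rewrite -e negbK => h; exists n => //; lia.
have [n nr h] := IH s ne; exists n; first by lia.
apply: leq_ltn_trans h.
have rK : radius_ok m (~~ s') (stub_len m) by rewrite /radius_ok m0 /stub_len; case: ifP;
  rewrite /flip_rho; lia.
have := @unfold_le m (stub_len m) (~~ s') n rK z z wz wz; rewrite negbK; apply.
- by rewrite /inner lz.
- by rewrite /reach (negbTE lz); lia.
by rewrite /uncut; apply/andP; split; apply/negP => /and3P[_ /eqP -> /eqP e2];
  have := anchor_neq_moved m0; rewrite e2 eqxx.
Qed.

(** * The two trees *)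

Definition vert : eqType := {x : raw | wf x}.

Definition vadj s : rel vert := fun x y => val y \in nbrs s (val x).

Lemma vadj_sym s : symmetric (vadj s).
Proof. by move=> x y; apply/idP/idP; apply: nbrs_sym; apply: valP. Qed.

Lemma vadj_irr s : irreflexive (vadj s).
Proof. by move=> x; apply: nbrs_irr; apply: valP. Qed.

Definition tree s : graph := Graph (@vadj_sym s) (@vadj_irr s).

Definition vroot : vert := exist _ root isT.

Lemma tree_connected s : connected (tree s).
Proof.
split; first by exists vroot.
have up (x : tree s) : exists2 p, path (@adj (tree s)) x p & last x p = vroot.
  have [d dx] := ubnP (dep s (val x)); elim: d x dx => // d IH x dx.
  have [xr|xr] := eqVneq (val x) root; first by exists [::] => //=; apply: val_inj.
  have wx := valP x; pose y : tree s := exist _ (par s (val x)) (par_wf s wx xr).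
  have [|p py ly] := IH y; first by have := dep_par s wx xr; move: dx; rewrite /y /=; lia.
  by exists (y :: p) => //=; rewrite py andbT; apply: par_nbrs.
move=> x y; have [p px lx] := up x; have [r ry ly] := up y.
exists (p ++ rev (belast y r)); last by case: r ry ly => [|z r] //= _ ly;
  rewrite ?cats0 ?lx ?rev_cons ?last_cat ?last_rcons //.
rewrite cat_path px lx -ly /= rev_path.
by rewrite (eq_path (e' := @adj (tree s))) // => u w; apply: vadj_sym.
Qed.

Lemma max_mem (T : eqType) (F : T -> nat) (c : seq T) :
  c != [::] -> exists2 x, x \in c & forall y, y \in c -> F y <= F x.
Proof.
elim: c => // x [|z c] IH _; first by exists x; rewrite ?mem_head // => y; rewrite inE => /eqP ->.
have [//|m mc H] := IH; case: (leqP (F x) (F m)) => le.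
  by exists m; [rewrite inE mc orbT|move=> y; rewrite inE => /orP[/eqP ->|/H]].
exists x; first by rewrite mem_head.
by move=> y; rewrite inE => /orP[/eqP -> //|/H]; lia.
Qed.

(** At a vertex of maximal [dep] on a cycle, both neighbours on the cycle would be its parent. *)
Lemma tree_acyclic s : acyclic (tree s).
Proof.
move=> c c3 /andP[cc uc].
have cn : c != [::] by case: (c) c3.
have [x xc mx] := max_mem (fun y : tree s => dep s (val y)) cn.
have key (y : tree s) : y \in c -> adj x y -> par s (val x) = val y.
  move=> yc; case/(nbrs_par (valP x)) => [[_ //]|[yr e]].
  by have := dep_par s (valP y) yr; rewrite e; have := mx y yc; lia.
have [i c' e] := rot_to xc.
have sc : size c' >= 2 by move: c3; rewrite -(size_rot i) e.
have mc (y : tree s) : y \in x :: c' -> y \in c by rewrite -e mem_rot.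
have := uc; rewrite -(rot_uniq i) e; have := cc; rewrite -(rot_cycle i) e.
case: c' e sc mc => [//|y c'] e sc mc /= /andP[xy];
  rewrite rcons_path => /andP[_ zx] /and3P[_ yc' _].
have zx' : adj x (last y c') by rewrite adj_sym.
have h1 := key y (mc y _) xy; have h2 := key _ (mc (last y c') _) zx'.
have : y = last y c'.
  apply: val_inj; rewrite /= -h1 -?h2 //; first by rewrite inE mem_last orbT.
  by rewrite !inE eqxx orbT.
case: c' sc yc' {e mc zx zx' h1 h2} => // z c' _ yn ye.
by move: yn; rewrite {1}ye /= mem_last.
Qed.

Lemma tree_is_tree s : is_tree (tree s).
Proof. by split; [exact: tree_connected|exact: tree_acyclic]. Qed.

Lemma tree_infinite s : infinite_graph (tree s).
Proof.
pose f k : vert := exist _ (hubv true k) (wf_hubv true k).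
have fi : injective f by move=> j k [].
apply/infiniteP; have /card_eqPle[_ h] : (image setT f #= [set: nat])%card.
  by apply: inj_card_eq => j k _ _; apply: fi.
exact: card_le_trans h (card_leT _).
Qed.

Lemma neighbours_image s (x : tree s) :
  neighbours x =
  image (`I_(size (nbrs s (val x)))) (fun k => insubd x (nth root (nbrs s (val x)) k)).
Proof.
have wn k : k < size (nbrs s (val x)) -> wf (nth root (nbrs s (val x)) k).
  by move=> lk; apply: nbrs_wf (valP x) (mem_nth _ lk).
apply/seteqP; split=> y /=.
  move=> xy; have xy' : val y \in nbrs s (val x) by [].
  exists (index (val y) (nbrs s (val x))); first by rewrite /= index_mem.
  by apply: val_inj; rewrite val_insubd nth_index // (valP y).
by case=> k lk <-; rewrite /neighbours /= /vadj val_insubd wn // mem_nth.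
Qed.

Lemma tree_degree s : has_max_degree (tree s) 3.
Proof.
split=> [x|].
  rewrite neighbours_image; apply: card_le_trans (card_image_le _ _) _.
  by rewrite card_le_II size_nbrs //; apply: valP.
exists vroot; rewrite neighbours_image; have -> : size (nbrs s (val vroot)) = 3 by case: s.
apply: inj_card_eq => j k; rewrite !inE /= => lj lk /(congr1 val).
have sz : size (nbrs s root) = 3 by case: s.
have wn i : i < 3 -> wf (nth root (nbrs s root) i).
  by move=> li; apply: (@nbrs_wf s root) => //; apply: mem_nth; rewrite sz.
rewrite !val_insubd !wn // => /eqP; rewrite nth_uniq ?sz // ?nbrs_uniq //.
by move/eqP.
Qed.

(** * Hypomorphism *)

Lemma flip_vert m (x : vert) : 0 < m -> wf (flip m (val x)).
Proof. by move=> m0; apply: flip_wf => //; apply: valP. Qed.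

Definition vflip m (m0 : 0 < m) (x : vert) : vert := exist _ (flip m (val x)) (flip_vert x m0).

Lemma vflipK m (m0 : 0 < m) : involutive (vflip m0).
Proof. by move=> x; apply: val_inj; rewrite /= flipK //; apply: valP. Qed.

Lemma del_iso m (m0 : 0 < m) s (x : vert) : s = odd m -> val x = moved m ->
  isomorphic (@del_vertex (tree s) x) (@del_vertex (tree (~~ s)) (vflip m0 x)).
Proof.
move=> so xv.
have P1 (y : vert) : predC1 x y -> predC1 (vflip m0 x) (vflip m0 y).
  by rewrite /= (can_eq (vflipK m0)).
have P2 (y : vert) : predC1 (vflip m0 x) y -> predC1 x (vflip m0 y).
  by rewrite /= -(can_eq (vflipK m0)) vflipK.
exists (fun y => exist _ (vflip m0 (val y)) (P1 _ (valP y))); split.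
  by exists (fun y => exist _ (vflip m0 (val y)) (P2 _ (valP y))) => -[y yP]; apply/eqP;
    rewrite -val_eqE /= vflipK.
move=> y z; rewrite /= /induced_adj /= /vadj /= so.
have ne (u : {y : vert | predC1 x y}) : val (val u) != moved m.
  by rewrite -xv; have := valP u; rewrite /= -val_eqE.
exact: (flip_iso m0 (valP (val y)) (valP (val z)) (ne y) (ne z)).
Qed.

Lemma isomorphic_sym G H : isomorphic G H -> isomorphic H G.
Proof.
case=> f [[g fg gf] fa]; exists g; split; first by exists f.
by move=> x y; rewrite -fa !gf.
Qed.

Lemma moves s : exists f : vert -> vert, injective f /\
  forall x, isomorphic (@del_vertex (tree s) x) (@del_vertex (tree (~~ s)) (f x)).
Proof.
have stage (x : vert) : exists m, [/\ 0 < m, odd m = s, moved m = val x & level (val x) < m].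
  by apply: moved_onto; apply: valP.
have [m Hm] := choice stage.
have m0 x : 0 < m x by case: (Hm x).
exists (fun x => vflip (m0 x) x); split.
  (* As the level is below the stage, the flip prepends a letter; dropping it recovers the vertex,
     whatever the stage. *)
  move=> x y /(congr1 val) /=; have [_ _ _ lx] := Hm x; have [_ _ _ ly] := Hm y.
  rewrite !flip_cons ?ltn_eqF // => -[_ e1 e2]; apply: val_inj.
  by rewrite [LHS]surjective_pairing [RHS]surjective_pairing; congr pair.
by move=> x; have [_ so xv _] := Hm x; apply: del_iso.
Qed.

(** The usual bijection takes [f] on the orbits under [g \o f] of points outside the range of [g],
    and the inverse of [g] elsewhere, so each of its values inherits [R]. *)
Lemma cantor_bernstein_rel (A B : Type) (R : A -> B -> Prop) (f : A -> B) (g : B -> A) :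
  injective f -> injective g -> (forall x, R x (f x)) -> (forall y, R (g y) y) ->
  exists phi : A -> B, bijective phi /\ forall x, R x (phi x).
Proof.
move=> fi gi Rf Rg.
pose orphan x := exists n z, (forall y, g y <> z) /\ x = iter n (g \o f) z.
have pre x : exists y, if `[< orphan x >] then y = f x else g y = x.
  case: asboolP => h; first by exists (f x).
  apply/not_existsP => no; apply: h; exists 0, x; split=> // y; exact: no.
have [phi Hphi] := choice pre.
have Hin x : orphan x -> phi x = f x by move=> /asboolP h; have := Hphi x; rewrite h.
have Hout x : ~ orphan x -> g (phi x) = x by move=> /asboolPn/negbTE h; have := Hphi x; rewrite h.
have step x : orphan x -> orphan (g (f x)) by move=> [n [z [hz ->]]]; exists n.+1, z.
exists phi; split; last first.
  move=> x; case: (pselect (orphan x)) => h; first by rewrite Hin.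
  by rewrite -{1}(Hout x h).
have inj : injective phi.
  move=> x y e; case: (pselect (orphan x)) => hx; case: (pselect (orphan y)) => hy.
  - by apply: fi; rewrite -!Hin.
  - by case: (hy); rewrite -(Hout y hy) -e Hin //; apply: step.
  - by case: (hx); rewrite -(Hout x hx) e Hin //; apply: step.
  - by rewrite -(Hout x hx) e Hout.
have surj y : exists x, phi x = y.
  case: (pselect (orphan (g y))) => h; last by exists (g y); apply: gi; apply: Hout.
  case: h => -[|n] [z [hz e]]; first by case: (hz y).
  by exists (iter n (g \o f) z); rewrite Hin; [apply/gi/esym|exists n, z].
have [psi Hpsi] := choice surj.
by exists psi => // x; apply: inj; rewrite Hpsi.
Qed.

Lemma trees_hypomorphic : hypomorphic (tree true) (tree false).
Proof.
have [f [fi Hf]] := moves true; have [g [gi Hg]] := moves false.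
pose R (x : tree true) (y : tree false) := isomorphic (del_vertex x) (del_vertex y).
exact: (@cantor_bernstein_rel _ _ R f g fi gi Hf (fun y => isomorphic_sym (Hg y))).
Qed.

(** * Embeddings do not shrink balls *)

Lemma embeds_cnt s s' (f : tree s -> tree s') n (x0 x : tree s) : injective f ->
  (forall x y, adj x y -> adj (f x) (f y)) ->
  cnt n s (val x0) (val x) <= cnt n s' (val (f x0)) (val (f x)).
Proof.
move=> fi fa; elim: n x0 x => [//|n IH] x0 x; rewrite !cntS ltnS.
have wfn y : y \in nbrs s (val x) -> wf y by apply: nbrs_wf; apply: valP.
(* Extends [f] to all raw words, with a default value on those that are not vertices. *)
pose g (y : raw) : raw := if insub y is Some u then val (f u) else y.
have gE (u : tree s) : g (val u) = val (f u) by rewrite /g valK.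
have vx y : y \in away s (val x0) (val x) -> exists2 u : tree s, val u = y &
  @adj (tree s) x u /\ u != x0.
  rewrite mem_filter => /andP[y0 yn]; exists (exist _ y (wfn y yn)) => //; split=> //.
apply: (@sumn_inj_le _ _ _ _ _ _ g).
- by apply: away_uniq; apply: valP.
- move=> y z /vx[u <- _] /vx[w <- _]; rewrite !gE => e.
  by congr val; apply: fi; apply: val_inj.
move=> y /vx[u <- [au u0]]; rewrite gE; split; last exact: IH.
rewrite mem_filter; apply/andP; split; last exact: fa au.
by apply: contraNneq u0 => e; apply/eqP/fi/val_inj.
Qed.

(** A ball around the root would be injected into a strictly smaller ball around its image. *)
Lemma no_embedding s : ~ embeds (tree s) (tree (~~ s)).
Proof.
case=> f [fi fa]; have [|n _] := @gap s (~~ s) (val (f vroot)) (valP _).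
  by case: (s).
have := embeds_cnt n vroot vroot fi fa; rewrite /=; lia.
Qed.

Theorem theorem1p6 :
  exists T S : graph,
    (is_tree T /\ infinite_graph T /\ has_max_degree T 3) /\
    (is_tree S /\ infinite_graph S /\ has_max_degree S 3) /\
    hypomorphic T S /\
    ~ embeds T S /\
    ~ embeds S T.
Proof.
have ok s : is_tree (tree s) /\ infinite_graph (tree s) /\ has_max_degree (tree s) 3.
  by split; [exact: tree_is_tree|split; [exact: tree_infinite|exact: tree_degree]].
exists (tree true), (tree false); split; [exact: ok|split; [exact: ok|split]].
  exact: trees_hypomorphic.
by split; [exact: (@no_embedding true)|exact: (@no_embedding false)].
Qed.
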